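(* Let $X$ be a Banach space and $f_k:X\to\mathbb{R}\cup\{+\infty\}$ $(k\in\mathbb{N}\cup\{0\})$ proper convex functions such that $C:=\operatorname{dom}f_0\cap\{x: f_k(x)\le0\ \forall k\in\mathbb{N}\}\neq\emptyset$. Let $\bar x\in X$ be a solution of problem (P): minimize $f_0(x)$ subject to $f_k(x)\le0$ $(k\in\mathbb{N})$. Suppose the Slater condition holds (there exists $x\in\operatorname{dom}f_0$ with $\sup_{k\in\mathbb{N}}f_k(x)<0$), and there exists a solution $\lambda=(\lambda_1,\lambda_2,\ldots)\in\ell^1_+$, $\lambda_\infty\in\mathbb{R}_+$ of problem (D) such that (i) the functions $f_0$, $\lambda_kf_k$ $(k\in\mathbb{N}\cup\{\infty\})$ are lower semicontinuous and bounded from below on a neighbourhood of $\bar x$; (ii) the collection $\{f_0,\ \lambda_kf_k\ (k\in\mathbb{N}\cup\{\infty\})\}$ is uniformly lower semicontinuous on a neighbourhood of $\bar x$. Then $\lambda_kf_k(\bar x)=0$ for all $k\in\mathbb{N}\cup\{\infty\}$, and for any $\varepsilon>0$ and $M>0$ there exist $n\in\mathbb{N}$ with $n>M$ and points $x_k\in B_\varepsilon(\bar x)$ $(k=0,\ldots,n)$ and $x_\infty\in B_\varepsilon(\bar x)$ such that $$f_0(x_0)+\sum_{k=1}^n\lambda_kf_k(x_k)+\lambda_\infty f_\infty(x_\infty)\le f_0(\bar x),$$ $$0\in\partial f_0(x_0)+\sum_{k=1}^n\lambda_k\partial f_k(x_k)+\lambda_\infty\partial f_\infty(x_\infty)+\varepsilon\mathbb{B}^*,$$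 with the convention $\lambda_k\partial f_k(x_k)=N_{\operatorname{dom}f_k}(x_k)$ when $\lambda_k=0$ $(k\in\mathbb{N}\cup\{\infty\})$.
   Context: Conventions: $0\cdot(+\infty)=+\infty$ (so $0\cdot f_k$ is the indicator function of $\operatorname{dom}f_k$), $(+\infty)-(+\infty)=+\infty$. $f_\infty(x):=\limsup_{k\to\infty}f_k(x)$. (D) is the problem $\sup_{\lambda\in\ell^1_+,\lambda_\infty\ge0}\inf_{x\in X}\big(f_0(x)+\overline{\sum_{k\in\mathbb{N}}}\lambda_kf_k(x)+\lambda_\infty f_\infty(x)\big)$, where $\overline{\sum_{k\in\mathbb{N}}}\lambda_kf_k(x):=\limsup_{n\to\infty}\sum_{k=1}^n\lambda_kf_k(x)$ and $\ell^1_+$ is the set of nonnegative sequences in $\ell^1$; a solution attains the supremum. $B_\varepsilon(\bar x)$ is the open ball, $\mathbb{B}^*$ the open unit ball of $X^*$, $\partial$ the Fenchel subdifferential $\partial f(x)=\{x^*: f(y)-f(x)\ge\langle x^*,y-x\rangle\ \forall y\}$, and $N_A(x)$ the normal cone of convex analysis to $A$ at $x$. Uniform lower semicontinuity: for a nonempty index set $T$ (here $T=\mathbb{N}\cup\{0,\infty\}$ with $g_0=f_0$, $g_k=\lambda_kf_k$), let $\mathcal{F}(T)$ be the finite subsets of $T$ directed by inclusion, $\limsup_{S\uparrow T}\alpha_S:=\inf_{S_0}\sup_{S\supset S_0}\alpha_S$, $\liminf_{S\uparrow T}\alpha_S:=\sup_{S_0}\inf_{S\supset S_0}\alpha_S$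 over $S,S_0\in\mathcal{F}(T)$; $\big(\overline{\sum_{t\in T}}g_t\big)(x):=\limsup_{S\uparrow T}\sum_{t\in S}g_t(x)$; for $U\subset X$, $\Lambda_U(\{g_t\}):=\liminf_{S\uparrow T}\lim_{\delta\downarrow0}\inf\{\sum_{t\in S}g_t(x_t): x_t\in U,\ \operatorname{diam}\{x_t\}_{t\in S}<\delta\}$. The collection is uniformly lower semicontinuous on $U$ if $\inf_U\overline{\sum_{t\in T}}g_t\le\Lambda_U(\{g_t\})$. *)

(* Defs.v *)
From HB Require Import structures.
From mathcomp Require Import all_boot all_order all_algebra.
From mathcomp Require Import all_classical all_reals all_analysis.
From mathcomp Require Import finmap.
Set Implicit Arguments. Unset Strict Implicit. Unset Printing Implicit Defensive.
Import Order.TTheory GRing.Theory Num.Theory.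
Import numFieldNormedType.Exports.
Local Open Scope classical_set_scope.
Local Open Scope ring_scope.
Local Open Scope ereal_scope.

(* Functions take values in \bar R; the value -oo
   is excluded for the data f_k by properness.  All additions of extended
   reals below use the dual addition [(_ + _)%dE], for which
   (+oo) + (-oo) = +oo, i.e. the paper's convention (+oo)-(+oo)=+oo. *)

Section Defs.
Variable R : realType.

(* lambda * v with the convention 0 * (+oo) = +oo (so 0 * f is the indicator
   of dom f). *)
Definition scl (l : R) (v : \bar R) : \bar R :=
  if l == 0%R then (if v == +oo then +oo else 0) else l%:E * v.

Variable X : normedModType R.

Definition dom (f : X -> \bar R) : set X := [set x | f x < +oo].

Definition proper_fun (f : X -> \bar R) :=
  (forall x, f x != -oo) /\ exists x, f x < +oo.

Definition convex_fun (f : X -> \bar R) :=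
  forall (x y : X) (t : R), (0 < t < 1)%R ->
    f (t *: x + (1 - t) *: y)%R <= (t%:E * f x + (1 - t)%:E * f y)%dE.

Definition lsc_at (f : X -> \bar R) (x : X) :=
  forall a : R, a%:E < f x -> \forall y \near x, a%:E < f y.

Definition bounded_below_on (f : X -> \bar R) (U : set X) :=
  exists m : R, forall x, U x -> m%:E <= f x.

Definition dual_elem (p : X -> R) :=
  (forall (a : R) (x y : X), p (a *: x + y) = a * p x + p y)%R /\ continuous p.

Definition dual_norm_lt (p : X -> R) (e : R) :=
  exists2 c : R, (c < e)%R & forall y : X, (`|p y| <= c * `|y|)%R.

Definition subdiff (f : X -> \bar R) (x : X) : set (X -> R) :=
  [set p | dual_elem p /\ f x < +oo /\
     forall y, (p (y - x)%R)%:E <= (f y - f x)%dE].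

Definition normal_cone (A : set X) (x : X) : set (X -> R) :=
  [set p | dual_elem p /\ A x /\ forall y, A y -> (p (y - x) <= 0)%R].

Definition scaled_subdiff (l : R) (f : X -> \bar R) (x : X) : set (X -> R) :=
  if l == 0%R then normal_cone (dom f) x
  else [set p | exists2 q, subdiff f x q & forall y, p y = (l * q y)%R].

Definition f_infty (f : nat -> X -> \bar R) (x : X) : \bar R :=
  limn_esup (fun k => f k x).

(* Objective of the dual problem (D) at (lambda, lambda_oo); lambda k is
   lambda_k for k >= 1 (lambda 0 is unused); f 0 is f_0. *)
Definition D_obj (f : nat -> X -> \bar R) (l : nat -> R) (linf : R) (x : X) :=
  (f 0%N x + limn_esup (fun n => (\sum_(1 <= k < n.+1) scl (l k) (f k x))%dE)
     + scl linf (f_infty f x))%dE.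

Definition D_val (f : nat -> X -> \bar R) (l : nat -> R) (linf : R) : \bar R :=
  ereal_inf (range (D_obj f l linf)).

Definition D_adm (l : nat -> R) (linf : R) :=
  (forall k, 0 <= l k)%R /\ cvgn (series l) /\ (0 <= linf)%R.

Definition D_solution (f : nat -> X -> \bar R) (l : nat -> R) (linf : R) :=
  D_adm l linf /\
  D_val f l linf = ereal_sup [set D_val f m.1 m.2 | m in [set m : (nat -> R) * R | D_adm m.1 m.2]].

Definition feasible (f : nat -> X -> \bar R) : set X :=
  [set x | f 0%N x < +oo /\ forall k, (0 < k)%N -> f k x <= 0].

Definition P_solution (f : nat -> X -> \bar R) (xb : X) :=
  feasible f xb /\ forall x, feasible f x -> f 0%N xb <= f 0%N x.

Definition slater (f : nat -> X -> \bar R) :=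
  exists x, f 0%N x < +oo /\
    ereal_sup [set f k x | k in [set k : nat | (0 < k)%N]] < 0.

(* the family g indexed by T = N u {0, oo}, encoded as option nat:
   Some 0 = f_0, Some k = lambda_k f_k (k >= 1), None = lambda_oo f_oo *)
Definition gfam (f : nat -> X -> \bar R) (l : nat -> R) (linf : R)
    (t : option nat) (x : X) : \bar R :=
  match t with
  | Some 0%N => f 0%N x
  | Some k => scl (l k) (f k x)
  | None => scl linf (f_infty f x)
  end.

Local Open Scope fset_scope.
Definition limsup_fin (a : {fset option nat} -> \bar R) : \bar R :=
  ereal_inf [set ereal_sup [set a S | S in [set S | S0 `<=` S]] | S0 in setT].
Definition liminf_fin (a : {fset option nat} -> \bar R) : \bar R :=
  ereal_sup [set ereal_inf [set a S | S in [set S | S0 `<=` S]] | S0 in setT].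

Definition osum (g : option nat -> X -> \bar R) (x : X) : \bar R :=
  limsup_fin (fun S => (\sum_(t <- S) g t x)%dE).

Definition Lam_inner (g : option nat -> X -> \bar R) (U : set X)
    (S : {fset option nat}) (d : R) : \bar R :=
  ereal_inf [set (\sum_(t <- S) g t (xs t))%dE | xs in
    [set xs : option nat -> X | (forall t, t \in S -> U (xs t)) /\
       forall s t, s \in S -> t \in S -> (`|(xs s - xs t)%R| < d)%R]].

(* Lambda_U({g_t}); the inner quantity is nondecreasing as d decreases, so
   lim_{d -> 0+} is the supremum over d > 0 *)
Definition Lam (g : option nat -> X -> \bar R) (U : set X) : \bar R :=
  liminf_fin (fun S => ereal_sup [set Lam_inner g U S d | d in [set d : R | (0 < d)%R]]).

Definition unif_lsc (g : option nat -> X -> \bar R) (U : set X) :=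
  ereal_inf (osum g @` U) <= Lam g U.

End Defs.

(* Main.v *)
(** Under the Slater condition, [f 0 + K * (sup_k f k)^+] is minimized at [xb]
    for some [K]. The Hahn-Banach theorem on the space of bounded sequences
    turns this penalty into a positive functional, whose values on the unit
    vectors and at infinity are multipliers attaining the value of (P) in (D).
    Hence the given dual solution has no gap, which forces complementarity at
    [xb]. Uniform lower semicontinuity then says that, for large [n], the sum of
    the decoupled functions at nearby points [x_t] almost exceeds [f 0 xb].
    A multiple of the spread [sum_t |x_t - x_0|] extends this to a whole ball;
    Ekeland's principle for the max-norm gives a minimizer, and the sandwich
    theorem splits it into subgradients. The penalty is invariant under common
    translations, so only the small Ekeland term remains in their sum. *)
Require Import Defs.
From HB Require Import structures.
From mathcomp Require Import all_boot all_order all_algebra.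
From mathcomp Require Import all_classical all_reals all_analysis.
From mathcomp Require Import finmap ring lra.
Import Order.TTheory GRing.Theory Num.Theory.
Import numFieldNormedType.Exports DualAddTheory.
Local Open Scope classical_set_scope.
Local Open Scope ring_scope.

(** * The Hahn-Banach and sandwich theorems *)

Section HahnBanach.
Context {R : realType} {V : lmodType R}.
Implicit Types (q : V -> R) (x y z : V).

Definition sublinear q :=
  (forall x y, q (x + y) <= q x + q y) /\
  (forall (s : R) x, 0 < s -> q (s *: x) <= s * q x).

Definition linear_form q := forall (a : R) x y, q (a *: x + y) = a * q x + q y.

Lemma sublinear0 q : sublinear q -> q 0 = 0.
Proof.
move=> [_ qZ]; have := qZ 2%:R 0 ltac:(lra); have := qZ 2%:R^-1 0 ltac:(lra).
rewrite !scaler0; lra.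
Qed.

Lemma sublinearN q x : sublinear q -> - q (- x) <= q x.
Proof.
move=> q_sub; have := q_sub.1 x (- x); rewrite subrr sublinear0//; lra.
Qed.

Lemma sublinearZ q (s : R) x : sublinear q -> 0 <= s -> q (s *: x) = s * q x.
Proof.
move=> q_sub; rewrite le_eqVlt => /predU1P[<-|s_gt0].
  by rewrite scale0r mul0r sublinear0.
apply/eqP; rewrite eq_le q_sub.2//=.
have /(q_sub.2 _ (s *: x)) : 0 < s^-1 by rewrite invr_gt0.
by rewrite scalerA mulVf ?gt_eqF// scale1r ler_pdivlMl.
Qed.

Lemma linear_form0 q : linear_form q -> q 0 = 0.
Proof. by move=> q_lin; have := q_lin 1 0 0; rewrite scale1r addr0; lra. Qed.

(** Additivity gives [q (- z) = - q z], which carries positive homogeneity over to negative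
    scalars. *)
Lemma additive_sublinear q : sublinear q ->
  (forall x y, q (x + y) = q x + q y) -> linear_form q.
Proof.
move=> q_sub qD a x y; rewrite qD; congr (_ + _).
have [a_ge0|a_lt0] := leP 0 a; first exact: sublinearZ.
have qN z : q (- z) = - q z.
  by have := qD z (- z); rewrite subrr sublinear0//; lra.
by rewrite -[a *: x]opprK -scaleNr qN sublinearZ ?mulNr ?opprK//; lra.
Qed.

Section Infimum.
Context {I : Type} (D : set I) (F : I -> V -> R).
Hypothesis D_neq0 : D !=set0.
Hypothesis F_lb : forall y, exists b, forall i, D i -> b <= F i y.

Definition inf_fun y := inf [set F i y | i in D].

Lemma inf_fun_le i y : D i -> inf_fun y <= F i y.
Proof.
move=> Di; apply: ge_inf; last by exists i.
by have [b bP] := F_lb y; exists b => _ [j Dj <-]; exact: bP.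
Qed.

Lemma le_inf_fun b y : (forall i, D i -> b <= F i y) -> b <= inf_fun y.
Proof.
move=> bP; apply: lb_le_inf; first by have [i Di] := D_neq0; exists (F i y), i.
by move=> _ [i Di <-]; exact: bP.
Qed.

(** The index [k] merges near-minimizers [i] and [j] of the two infima. This serves three infima:
    over a chain in Zorn's lemma, over the perturbations along one direction in [hahn_banach], and
    over the scaled epigraph in [sandwich]. *)
Lemma sublinear_inf_fun :
  (forall i j x y, D i -> D j ->
    exists2 k, D k & F k (x + y) <= F i x + F j y) ->
  (forall i (s : R) x, D i -> 0 < s ->
    exists2 k, D k & F k (s *: x) <= s * F i x) ->
  sublinear inf_fun.
Proof.
move=> FD FZ; split=> [x y|s x s_gt0].
  rewrite -lerBlDr; apply: le_inf_fun => i Di.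
  rewrite lerBlDr -lerBlDl; apply: le_inf_fun => j Dj; rewrite lerBlDl.
  have [k Dk /(le_trans _)] := FD i j x y Di Dj; apply; exact: inf_fun_le.
rewrite -ler_pdivrMl//; apply: le_inf_fun => i Di; rewrite ler_pdivrMl//.
have [k Dk /(le_trans _)] := FZ i s x Di s_gt0; apply; exact: inf_fun_le.
Qed.

End Infimum.

(** Zorn's lemma for the reversed pointwise order on the sublinear functionals below [p]. *)
Lemma minimal_sublinear (p : V -> R) : sublinear p ->
  exists q, [/\ sublinear q, (forall x, q x <= p x) &
    forall r, sublinear r -> (forall x, r x <= q x) -> r = q].
Proof.
move=> p_sub.
pose T := {q | sublinear q /\ forall x, q x <= p x}.
pose le_rev (q r : T) := `[< forall x, sval r x <= sval q x >].
have [| | | |[q [q_sub qp]] q_min] := @Zorn T le_rev.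
- by move=> q; apply/asboolP.
- move=> q r s /asboolP rq /asboolP sr; apply/asboolP => x.
  exact: le_trans (sr x) (rq x).
- move=> [q qP] [r rP] /asboolP rq /asboolP qr; apply: eq_exist.
  by apply/funext => x; apply/eqP; rewrite eq_le qr rq.
(* A nonempty chain is bounded by its pointwise infimum, which is finite because [q y >= - p (- y)]
   for every [q] below [p]. Of two members of the chain the smaller one serves as the merged
   index. *)
- move=> A A_tot.
  have [[q0 Aq0]|A0] := pselect (A !=set0); last first.
    by exists (exist _ p (conj p_sub (fun x => lexx (p x)))) => s As; case: A0; exists s.
  pose F (q : T) := sval q.
  have F_lb y : exists b, forall i, A i -> b <= F i y.
    exists (- p (- y)) => -[q [q_sub qp]] _ /=.
    by apply: le_trans (sublinearN q y q_sub); rewrite lerN2.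
  have A_neq0 : A !=set0 by exists q0.
  have inf_sub : sublinear (inf_fun A F).
    apply: sublinear_inf_fun => //.
    - move=> q r x y Aq Ar; have [q_sub _] := svalP q; have [r_sub _] := svalP r.
      case: (A_tot _ _ Aq Ar) => /asboolP qr; [exists r|exists q] => //.
        by apply: le_trans (r_sub.1 x y) _; rewrite lerD2r; exact: qr.
      by apply: le_trans (q_sub.1 x y) _; rewrite lerD2l; exact: qr.
    - move=> q s x Aq s_gt0; exists q => //.
      by have [q_sub _] := svalP q; exact: q_sub.2.
  have inf_p x : inf_fun A F x <= p x.
    by apply: le_trans (inf_fun_le A F F_lb q0 x Aq0) _; exact: (svalP q0).2.
  exists (exist _ (inf_fun A F) (conj inf_sub inf_p)) => s As; apply/asboolP => x.
  exact: inf_fun_le.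
- exists q; split=> // r r_sub rq.
  have rp x : r x <= p x by exact: le_trans (rq x) (qp x).
  have := q_min (exist _ r (conj r_sub rp)).
  by move=> /(_ _)/(congr1 sval); apply; apply/asboolP.
Qed.

(* A minimal sublinear functional is linear: [inf_(t >= 0) q (x + t y) - t q y]
   is again sublinear and below [q], hence equal to [q]; take [t = 1]. *)
Theorem hahn_banach (p : V -> R) : sublinear p ->
  exists2 psi, linear_form psi & forall x, psi x <= p x.
Proof.
move=> /minimal_sublinear[q [q_sub qp q_min]]; exists q => //.
apply: additive_sublinear => // x y; apply/eqP; rewrite eq_le q_sub.1/=.
pose D := [set t : R | 0 <= t].
pose F t x := q (x + t *: y) - t * q y.
have F_lb z : exists b, forall t, D t -> b <= F t z.
  exists (- q (- z)) => t t_ge0; rewrite /F -(sublinearZ _ _ _ q_sub t_ge0).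
  by have := q_sub.1 (z + t *: y) (- z); rewrite addrAC subrr add0r; lra.
have D_neq0 : D !=set0 by exists 0; rewrite /D/=.
have inf_sub : sublinear (inf_fun D F).
  apply: sublinear_inf_fun => //.
  - move=> t s u v t_ge0 s_ge0; exists (t + s); first exact: addr_ge0.
    have := q_sub.1 (u + t *: y) (v + s *: y).
    by rewrite /F scalerDl addrACA; lra.
  - move=> t s u t_ge0 s_gt0; exists (s * t); first exact/mulr_ge0/t_ge0/ltW.
    by have := q_sub.2 s (u + t *: y) s_gt0; rewrite /F scalerDr scalerA; lra.
have inf_q u : inf_fun D F u <= q u.
  have := inf_fun_le D F F_lb 0 u (lexx 0).
  by rewrite /F scale0r addr0 mul0r subr0.
have infE := q_min _ inf_sub inf_q.
have := inf_fun_le D F F_lb 1 x ler01.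
by rewrite infE /F scale1r mul1r; lra.
Qed.

(** [E] plays the role of a convex epigraph, so that no infinite values occur. The infimum of
    [(a + H (z - t y)) / t] over [t > 0] and [E z a] is sublinear in [y]. A linear form below it
    satisfies both bounds: take [t = 1] with [y = z], respectively with the point [(0, 0)] of
    [E]. *)
Lemma sandwich (E : V -> R -> Prop) (H : V -> R) :
  (forall z a w b (t : R), 0 < t < 1 -> E z a -> E w b ->
     E (t *: z + (1 - t) *: w) (t * a + (1 - t) * b)) ->
  E 0 0 ->
  (forall z w (t : R), 0 < t < 1 ->
     H (t *: z + (1 - t) *: w) <= t * H z + (1 - t) * H w) ->
  H 0 = 0 ->
  (forall z a, E z a -> 0 <= a + H z) ->
  exists psi, [/\ linear_form psi, (forall z a, E z a -> psi z <= a) &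
    forall y, psi y <= H (- y)].
Proof.
move=> E_cvx E00 H_cvx H0 EH.
pose D := [set i : R * V * R | 0 < i.1.1 /\ E i.1.2 i.2].
pose F (i : R * V * R) y := (i.2 + H (i.1.2 - i.1.1 *: y)) / i.1.1.
(* The weights [s/(t+s)] and [t/(t+s)] make the increments [t x] and [s y]
   combine into a multiple of [x + y]. *)
have FD i j x y : D i -> D j ->
    exists2 k, D k & F k (x + y) <= F i x + F j y.
  move: i j => [[t z] a] [[s w] b] [/= t_gt0 Eza] [/= s_gt0 Ewb].
  have ts_gt0 : 0 < t + s by exact: addr_gt0.
  pose u := s / (t + s).
  have u01 : 0 < u < 1.
    by rewrite divr_gt0//= ltr_pdivrMr// mul1r; lra.
  have u1 : 1 - u = t / (t + s) by rewrite /u; field; rewrite gt_eqF.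
  exists (t * s / (t + s), u *: z + (1 - u) *: w, u * a + (1 - u) * b).
    by split=> /=; [rewrite divr_gt0// mulr_gt0 | exact: E_cvx].
  rewrite /F/=.
  have -> : u *: z + (1 - u) *: w - (t * s / (t + s)) *: (x + y) =
      u *: (z - t *: x) + (1 - u) *: (w - s *: y).
    rewrite !scalerBr !scalerDr opprD addrACA !scalerA.
    by congr (_ - _ + (_ - _)); congr (_ *: _); rewrite ?u1 /u; field; rewrite gt_eqF.
  have := H_cvx (z - t *: x) (w - s *: y) u u01.
  rewrite u1 ler_pdivrMr ?divr_gt0 ?mulr_gt0// => Hle.
  have -> : ((a + H (z - t *: x)) / t + (b + H (w - s *: y)) / s) *
      (t * s / (t + s)) = u * (a + H (z - t *: x)) + t / (t + s) * (b + H (w - s *: y)).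
    by rewrite /u; field; rewrite !gt_eqF.
  move: Hle; lra.
have FZ i (r : R) x : D i -> 0 < r -> exists2 k, D k & F k (r *: x) <= r * F i x.
  move: i => [[t z] a] [/= t_gt0 Eza] r_gt0; exists (t / r, z, a).
    by split=> //=; rewrite divr_gt0.
  rewrite /F/= scalerA divfK ?gt_eqF//.
  rewrite le_eqVlt; apply/orP; left; apply/eqP; field.
  by rewrite !gt_eqF.
have D_neq0 : D !=set0 by exists (1, 0, 0); split=> /=.
have F0 i : D i -> 0 <= F i 0.
  move: i => [[t z] a] [/= t_gt0 Eza]; rewrite /F/= scaler0 subr0.
  by rewrite divr_ge0 ?EH// ltW.
(* Splitting [0 = y + (- y)] by [FD] and using [F k 0 >= 0] bounds [F i y] from below independently
   of [i]. *)
have F_lb y : exists b, forall i, D i -> b <= F i y.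
  exists (- F (1, 0, 0) (- y)) => i Di.
  have [k Dk] := FD i (1, 0, 0) y (- y) Di ltac:(by split=> /=).
  by rewrite subrr; have := F0 k Dk; lra.
have [psi psi_lin psi_le] := hahn_banach _ (sublinear_inf_fun D F D_neq0 F_lb FD FZ).
exists psi; split=> // [z a Eza|y]; apply: le_trans (psi_le _) _.
  apply: le_trans (inf_fun_le D F F_lb (1, z, a) z _) _; first by split=> /=.
  by rewrite /F/= scale1r subrr H0 addr0 divr1.
apply: le_trans (inf_fun_le D F F_lb (1, 0, 0) y _) _; first by split=> /=.
by rewrite /F/= scale1r !sub0r add0r divr1.
Qed.

End HahnBanach.

(** * Ekeland's variational principle *)

Section Ekeland.
Context {R : realType} {E : Type} (d : E -> E -> R) (A : set E) (phi : E -> R).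
Hypothesis d_ge0 : forall x y, 0 <= d x y.
Hypothesis dxx : forall x, d x x = 0.
Hypothesis dC : forall x y, d x y = d y x.
Hypothesis d_triangle : forall x y z, d x z <= d x y + d y z.
Hypothesis A_complete : forall u : nat -> E, (forall n, A (u n)) ->
  (forall e, 0 < e -> exists N, forall m n, (N <= m)%N -> (N <= n)%N ->
     d (u m) (u n) < e) ->
  exists x, forall e, 0 < e -> \forall n \near \oo, d (u n) x < e.
Hypothesis phi_lsc : forall (u : nat -> E) x (c : R), (forall n, A (u n)) ->
  (forall e, 0 < e -> \forall n \near \oo, d (u n) x < e) ->
  (\forall n \near \oo, phi (u n) <= c) -> A x /\ phi x <= c.
Hypothesis phi_lb : exists m, forall x, A x -> m <= phi x.

(** [S x] collects the points that improve on [x] by at least [c] times their distance. Choosing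
    [u n.+1] within [e n] of the infimum of [phi] over [S (u n)] makes the diameters of these nested
    sets tend to 0, and the limit lies in all of them. In the application [d] is the max-norm over a
    finite list, hence a pseudometric; [phi_lsc] is the sequential closedness of the sublevel sets
    in [A]. *)
Lemma ekeland (x0 : E) (c : R) : A x0 -> 0 < c ->
  exists x, [/\ A x, phi x + c * d x0 x <= phi x0 &
    forall z, A z -> phi x <= phi z + c * d x z].
Proof.
move=> Ax0 c_gt0.
pose S x := [set y | A y /\ phi y + c * d x y <= phi x].
have Sxx x : A x -> S x x by move=> Ax; split=> //; rewrite dxx mulr0 addr0.
have S_trans x y z : S x y -> S y z -> S x z.
  move=> [Ay yx] [Az zy]; split=> //.
  by have := ler_wpM2l (ltW c_gt0) (d_triangle x y z); lra.
pose e n : R := n.+1%:R^-1.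
have e_gt0 n : 0 < e n by rewrite invr_gt0.
(* Stated for all points so that [choice] applies; [x0] is a default value outside [A]. *)
have stepP (nx : nat * E) : exists y, A nx.2 ->
    S nx.2 y /\ forall z, S nx.2 z -> phi y <= phi z + e nx.1.
  have [Ax|] := pselect (A nx.2); last by exists x0.
  have Slb : has_inf (phi @` S nx.2).
    split; first by exists (phi nx.2), nx.2 => //; exact: Sxx.
    by have [m mP] := phi_lb; exists m => _ [z [Az _] <-]; exact: mP.
  have [_ [y Sy <-] y_lt] := inf_adherent (e_gt0 nx.1) Slb.
  exists y => _; split=> // z Sz; apply: le_trans (ltW y_lt) _.
  by rewrite lerD2r; apply: ge_inf; [exact: Slb.2|exists z].
have [g gP] := choice stepP.
pose u := fix u n := if n is k.+1 then g (k, u k) else x0.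
have Au n : A (u n) by elim: n => // n IH; have [] := gP (n, u n) IH; case.
have Su n k : S (u n) (u (n + k)%N).
  elim: k => [|k IH]; first by rewrite addn0; exact: Sxx.
  by rewrite addnS; apply: S_trans IH _; have [] := gP ((n + k)%N, u (n + k)%N) (Au _).
have Smin n z : S (u n) z -> phi (u n.+1) <= phi z + e n.
  by have [_] := gP (n, u n) (Au n); apply.
(* Such a [z] also lies in [S (u n)], so it can improve on [u n.+1] by at most [e n]. *)
have Sd n z : S (u n.+1) z -> c * d (u n.+1) z <= e n.
  move=> Sz; have /Smin : S (u n) z.
    by apply: S_trans Sz; have := Su n 1%N; rewrite addn1.
  move: Sz => [_]; move: (u n.+1) => v; lra.
have e_small (r : R) : 0 < r -> exists N, e N < r.
  move=> r_gt0; exists (Num.bound r^-1); rewrite /e invf_plt ?posrE//.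
  by apply: lt_trans (archi_boundP _) _; rewrite ?invr_ge0 ?ltr_nat// ltW.
have [|x ux] := A_complete u Au.
  move=> r r_gt0; have [|N eN] := e_small (c * r / 2); first by rewrite divr_gt0// mulr_gt0.
  exists N.+1 => m n Nm Nn.
  have /Sd dm : S (u N.+1) (u m) by rewrite -(subnKC Nm); exact: Su.
  have /Sd dn : S (u N.+1) (u n) by rewrite -(subnKC Nn); exact: Su.
  rewrite -(ltr_pM2l c_gt0).
  have := ler_wpM2l (ltW c_gt0) (d_triangle (u m) (u N.+1) (u n)).
  by rewrite (dC (u m) (u N.+1)); lra.
have Sux n : S (u n) x.
  have key (r : R) : 0 < r -> A x /\ phi x <= phi (u n) - c * d (u n) x + c * r.
    move=> r_gt0; apply: (phi_lsc u) => //.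
    have [N _ NP] := ux _ r_gt0; exists (maxn N n) => // k /=; rewrite geq_max => /andP[Nk nk].
    have [_] : S (u n) (u k) by rewrite -(subnKC nk); exact: Su.
    have := ler_wpM2l (ltW c_gt0) (d_triangle (u n) (u k) x).
    by have := NP k Nk; rewrite -(ltr_pM2l c_gt0); lra.
  split; first by have [] := key 1 ltr01.
  rewrite -lerBrDr; apply/ler_addgt0Pr => r r_gt0.
  have [|_] := key (r / c); first exact: divr_gt0.
  by rewrite mulrCA divff ?mulr1// gt_eqF.
exists x; have [Ax xle] := Sux 0; split=> // z Az.
(* A violating [z] would belong to [S x], hence to every [S (u n)]; near-minimality of [u n.+1] then
   yields [phi x <= phi z] in the limit, a contradiction. *)
rewrite leNgt; apply/negP => z_lt.
have Sxz : S x z by split=> //; exact: ltW.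
have : phi x <= phi z.
  apply/ler_addgt0Pr => r /e_small[N eN].
  have := Smin N z (S_trans _ _ _ (Sux N) Sxz).
  have [_] := Sux N.+1; have := mulr_ge0 (ltW c_gt0) (d_ge0 (u N.+1) x); lra.
by have := mulr_ge0 (ltW c_gt0) (d_ge0 x z); lra.
Qed.

End Ekeland.

(** * Multipliers from functionals on bounded sequences *)

Lemma linear_form_sum {R : realType} {V : lmodType R} (psi : V -> R)
    (I : Type) (s : seq I) (a : I -> R) (v : I -> V) :
  linear_form psi ->
  psi (\sum_(i <- s) a i *: v i) = \sum_(i <- s) a i * psi (v i).
Proof.
move=> psi_lin; have psi0 := linear_form0 psi psi_lin.
by elim: s => [|i s IH]; rewrite ?big_nil// !big_cons psi_lin IH.
Qed.

Section BoundedSequences.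
Context {R : realType}.

Definition bounded_seq : {pred nat -> R} :=
  fun y => `[< exists b, forall k, `|y k| <= b >].

Lemma bounded_seq_submod_closed : submod_closed bounded_seq.
Proof.
split; first by apply/asboolP; exists 0 => k; rewrite normr0.
move=> a x y /asboolP[b xb] /asboolP[c yc]; apply/asboolP.
exists (`|a| * b + c) => k; apply: le_trans (ler_normD _ _) _.
by apply: lerD => //; rewrite normrM ler_wpM2l.
Qed.

HB.instance Definition _ :=
  GRing.isSubmodClosed.Build R (nat -> R) bounded_seq bounded_seq_submod_closed.

Record bddseq := Bddseq { bddseq_val :> nat -> R; _ : bddseq_val \in bounded_seq }.
HB.instance Definition _ := [isSub for bddseq_val].
HB.instance Definition _ := [Choice of bddseq by <:].
HB.instance Definition _ := [SubChoice_isSubLmodule of bddseq by <:].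

Lemma bddseqP (y : bddseq) : exists b, forall k, `|y k| <= b.
Proof. by have /asboolP := valP y. Qed.

Lemma bddseqD (y z : bddseq) k : (y + z) k = y k + z k.
Proof. by []. Qed.

Lemma bddseqZ (a : R) (y : bddseq) k : (a *: y) k = a * y k.
Proof. by []. Qed.

Lemma bddseq0 k : (0 : bddseq) k = 0.
Proof. by []. Qed.

Lemma bddseq_sum (I : Type) (s : seq I) (y : I -> bddseq) k :
  (\sum_(i <- s) y i) k = \sum_(i <- s) y i k.
Proof. by elim/big_rec2: _ => // i a b _ <-. Qed.

Lemma unit_seq_subproof k : (fun j => (j == k)%:R) \in bounded_seq.
Proof.
apply/asboolP; exists 1 => j; by case: eqP => _; rewrite ?normr0 ?normr1.
Qed.
Definition unit_seq k := Bddseq _ (unit_seq_subproof k).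

Lemma one_seq_subproof : (fun=> 1) \in bounded_seq.
Proof. by apply/asboolP; exists 1 => j; rewrite normr1. Qed.
Definition one_seq := Bddseq _ one_seq_subproof.

Definition pos_sup (y : bddseq) : R := sup (range (fun k => Num.max 0 (y k))).

Lemma pos_sup_ub (y : bddseq) k : Num.max 0 (y k) <= pos_sup y.
Proof.
apply: ub_le_sup; last by exists k.
have [b bP] := bddseqP y; exists b => _ [j _ <-]; rewrite ge_max.
by rewrite (le_trans _ (bP j))//= (le_trans (ler_norm _))//.
Qed.

Lemma pos_sup_le (y : bddseq) (s : R) : (forall k, Num.max 0 (y k) <= s) -> pos_sup y <= s.
Proof.
move=> ys; apply: ge_sup; first by exists (Num.max 0 (y 0%N)), 0%N.
by move=> _ [k _ <-].
Qed.

Lemma pos_sup_npos (y : bddseq) : (forall k, y k <= 0) -> pos_sup y = 0.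
Proof.
move=> y_le0; have y0 k : Num.max 0 (y k) = 0 by apply/max_idPl.
apply/eqP; rewrite eq_le pos_sup_le => [|k]; last by rewrite y0.
by rewrite -(y0 0%N) pos_sup_ub.
Qed.

Lemma pos_sup_convex (z w : bddseq) (t : R) : 0 < t < 1 ->
  pos_sup (t *: z + (1 - t) *: w) <= t * pos_sup z + (1 - t) * pos_sup w.
Proof.
move=> /andP[t0 t1]; apply: pos_sup_le => k.
have := pos_sup_ub z k; have := pos_sup_ub w k.
rewrite !ge_max => /andP[w0 wk] /andP[z0 zk].
have t1' : 0 <= 1 - t by lra.
have := mulr_ge0 (ltW t0) z0; have := mulr_ge0 t1' w0.
have := ler_wpM2l (ltW t0) zk; have := ler_wpM2l t1' wk.
by rewrite bddseqD !bddseqZ => *; apply/andP; split; lra.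
Qed.

(* The linear form given by the sandwich theorem is a positive functional on
   bounded sequences. [l] is its sequence of values on the unit vectors, and
   [L - \sum_(k < N) l k] bounds its action on the tails beyond [N]. *)
Lemma sequence_multipliers (E : bddseq -> R -> Prop) (K : R) :
  (forall z a w b (t : R), 0 < t < 1 -> E z a -> E w b ->
     E (t *: z + (1 - t) *: w) (t * a + (1 - t) * b)) ->
  E 0 0 -> 0 <= K ->
  (forall z a, E z a -> 0 <= a + K * pos_sup z) ->
  exists (l : nat -> R) (L : R), [/\ forall k, 0 <= l k,
    forall n, \sum_(k < n) l k <= L &
    forall z a (c : R) N, E z a -> (forall k, (N <= k)%N -> z k <= c) ->
      0 <= a + \sum_(k < N) z k * l k + c * (L - \sum_(k < N) l k)].
Proof.
move=> E_cvx E00 K_ge0 EK.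
have [||psi [psi_lin psiE psiH]] := sandwich E (fun y => K * pos_sup y) E_cvx E00 _ _ EK.
- move=> z w t t01; have := ler_wpM2l K_ge0 (pos_sup_convex z w t t01); lra.
- by rewrite pos_sup_npos ?mulr0// => k; rewrite bddseq0.
have psi0 := linear_form0 psi psi_lin.
have psi_npos (y : bddseq) : (forall k, y k <= 0) -> 0 <= psi y.
  move=> y_le0; have := psi_lin (-1) y 0; rewrite addr0 psi0 scaleN1r.
  by have := psiH (- y); rewrite opprK (pos_sup_npos y)// mulr0; lra.
have psi_anti (y z : bddseq) : (forall k, y k <= z k) -> psi z <= psi y.
  move=> yz; have : 0 <= psi ((-1) *: z + y).
    by apply: psi_npos => k; rewrite bddseqD bddseqZ; have := yz k; lra.
  by rewrite psi_lin; lra.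
have psi_trunc (a : nat -> R) n : psi (\sum_(k < n) a k *: unit_seq k) =
    \sum_(k < n) a k * psi (unit_seq k) by exact: linear_form_sum.
have truncE (a : nat -> R) n j :
    (\sum_(k < n) a k *: unit_seq k) j = if (j < n)%N then a j else 0.
  have -> : (\sum_(k < n) a k *: unit_seq k) j = \sum_(k < n) a k * (j == k :> nat)%:R.
    by rewrite bddseq_sum.
  case: ifPn => jn.
    rewrite (bigD1 (Ordinal jn))//= eqxx mulr1 big1 ?addr0// => i.
    by rewrite -val_eqE/= eq_sym => /negbTE ->; rewrite mulr0.
  rewrite big1// => i _; case: eqP => [ji|]; last by rewrite mulr0.
  by move: jn; rewrite ji ltn_ord.
(* [psi] reverses the order, hence the signs. [L] is the total mass, the value of [- psi] on the
   constant sequence 1. *)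
exists (fun k => - psi (unit_seq k)), (- psi one_seq).
have sumN (a : nat -> R) n : \sum_(k < n) a k * - psi (unit_seq k) =
    - psi (\sum_(k < n) a k *: unit_seq k).
  by rewrite psi_trunc -sumrN; apply: eq_bigr => i _; rewrite mulrN.
have sumN1 n : \sum_(k < n) - psi (unit_seq k) =
    - psi (\sum_(k < n) 1 *: unit_seq k).
  by rewrite -(sumN (fun=> 1)); apply: eq_bigr => i _; rewrite mul1r.
split=> [k|n|z a c N Eza zc].
- by rewrite oppr_ge0 -psi0; apply: psi_anti => j /=; case: eqP.
- rewrite sumN1 lerN2; apply: psi_anti => j; rewrite (truncE (fun=> 1)) /=.
  by case: ifP.
- set u := \sum_(k < N) z k *: unit_seq k; set w := \sum_(k < N) 1 *: unit_seq k.
  (* The argument on the left agrees with [z] before [N] and equals [c] from [N] on, so it dominates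
     [z]. *)
  have : psi (u + c *: (one_seq + (-1) *: w)) <= psi z.
    apply: psi_anti => j; rewrite bddseqD bddseqZ bddseqD bddseqZ /u /w truncE.
    rewrite (truncE (fun=> 1))/=; case: ifPn => jN; first lra.
    by rewrite -leqNgt in jN; have := zc j jN; lra.
  rewrite [u + _]addrC psi_lin [one_seq + _]addrC psi_lin sumN sumN1 -/u -/w.
  have := psiE z a Eza; lra.
Qed.

End BoundedSequences.

(** * Extended-real convex functions *)

Section LimSup.
Context {R : realType}.
Implicit Types (u : nat -> \bar R) (c : \bar R).

Lemma limn_esup_lt u c : (limn_esup u < c)%E ->
  exists N, forall k, (N <= k)%N -> (u k < c)%E.
Proof.
move=> /ereal_inf_lt[_ [A [N _ NA] <-] supA]; exists N => k Nk.
by apply: le_lt_trans supA; apply: ereal_sup_ubound; exists k => //; exact: NA.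
Qed.

Lemma limn_esup_le u c N : (forall k, (N <= k)%N -> (u k <= c)%E) ->
  (limn_esup u <= c)%E.
Proof.
move=> uc; apply: ge_ereal_inf; exists (ereal_sup [set u k | k in [set k | (N <= k)%N]]).
  by exists [set k | (N <= k)%N] => //; exists N.
by apply: ge_ereal_sup => _ [k /= Nk <-]; exact: uc.
Qed.

Lemma limn_esup_ge u c : (forall N, exists2 k, (N <= k)%N & (c <= u k)%E) ->
  (c <= limn_esup u)%E.
Proof.
move=> uc; apply: le_ereal_inf_tmp => _ [A [N _ NA] <-].
have [k Nk /le_trans] := uc N; apply; apply: ereal_sup_ubound.
by exists k => //; exact: NA.
Qed.

End LimSup.

Lemma dsum_EFin {R : realType} (I : eqType) (s : seq I) (g : I -> \bar R) (c : I -> R) :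
  (forall i, i \in s -> g i = (c i)%:E) ->
  (\sum_(i <- s) g i)%dE = (\sum_(i <- s) c i)%:E.
Proof.
move=> gc; rewrite big_seq (eq_bigr (fun i => (c i)%:E)) => [|i si]; last exact: gc.
by rewrite -big_seq dsumEFin.
Qed.

Lemma dsum_pinfty {R : realType} (I : eqType) (s : seq I) (g : I -> \bar R) i :
  i \in s -> g i = +oo%E -> (\sum_(i <- s) g i)%dE = +oo%E.
Proof. by move=> si gi; rewrite (big_rem i)//= gi daddye. Qed.

Section EpiConvex.
Context {R : realType} {X : normedModType R}.
Implicit Types (g : X -> \bar R).

(* Convexity of the epigraph; unlike the inequality with extended-real
   right-hand side it needs no convention for infinite values. *)
Definition epi_convex g := forall x y (a b t : R), 0 < t < 1 ->
  (g x <= a%:E)%E -> (g y <= b%:E)%E ->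
  (g (t *: x + (1 - t) *: y)%R <= (t * a + (1 - t) * b)%:E)%E.

Lemma convex_fun_epi g : convex_fun g -> epi_convex g.
Proof.
move=> g_cvx x y a b t t01 gx gy; apply: le_trans (g_cvx x y t t01) _.
have /andP[t0 t1] := t01.
rewrite [leRHS]dEFinD; apply: lee_dD.
  by rewrite EFinM; apply: lee_wpmul2l => //; rewrite lee_fin ltW.
by rewrite EFinM; apply: lee_wpmul2l => //; rewrite lee_fin subr_ge0 ltW.
Qed.

Lemma lt_pinfty_le (v : \bar R) : (v < +oo)%E -> exists a : R, (v <= a%:E)%E.
Proof. by case: v => // [r _|_]; [exists r|exists 0; rewrite leNye]. Qed.

Lemma scl_gt0 (l : R) (v : \bar R) : 0 < l -> scl l v = (l%:E * v)%E.
Proof. by move=> l_gt0; rewrite /scl gt_eqF. Qed.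

Lemma scl_pinfty (l : R) : 0 <= l -> scl l +oo%E = +oo%E.
Proof.
rewrite /scl; have [//|l_neq0 l_ge0] := eqVneq l 0.
by rewrite gt0_muley// lte_fin lt_def l_neq0.
Qed.

Lemma scl0 (v : \bar R) : (v < +oo)%E -> scl 0 v = 0%E.
Proof. by rewrite /scl eqxx; case: v. Qed.

Lemma scl_EFin (l a : R) : scl l a%:E = (l * a)%:E.
Proof. by rewrite /scl; case: eqP => [->|//] /=; rewrite mul0r. Qed.

Lemma scl_lt_pinfty (l : R) (v : \bar R) : 0 <= l -> (scl l v < +oo)%E -> (v < +oo)%E.
Proof. by move=> l_ge0; case: v => // [r|]; rewrite ?ltry// scl_pinfty. Qed.

(** For [l = 0] the function is the indicator of the domain of [g], which is convex, and the bounds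
    [a], [b] are nonnegative. Otherwise the bounds are divided by [l]. *)
Lemma epi_convex_scl g (l : R) : 0 <= l -> epi_convex g ->
  epi_convex (fun x => scl l (g x)).
Proof.
move=> l_ge0 g_cvx x y a b t t01; have /andP[t0 t1] := t01.
have [l0|l_neq0] := eqVneq l 0.
  move=> gx gy.
  have [a' gx'] : exists a', (g x <= a'%:E)%E.
    exact/lt_pinfty_le/(scl_lt_pinfty l)/(le_lt_trans gx)/ltry.
  have [b' gy'] : exists b', (g y <= b'%:E)%E.
    exact/lt_pinfty_le/(scl_lt_pinfty l)/(le_lt_trans gy)/ltry.
  have gxy : (g (t *: x + (1 - t) *: y)%R < +oo)%E.
    by apply: le_lt_trans (g_cvx x y a' b' t t01 gx' gy') _; rewrite ltry.
  move: gx gy; rewrite l0 !scl0 ?(le_lt_trans gx') ?(le_lt_trans gy') ?ltry//.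
  rewrite !lee_fin => a_ge0 b_ge0.
  by apply: addr_ge0; apply: mulr_ge0 => //; lra.
have l_gt0 : 0 < l by rewrite lt_def l_neq0 l_ge0.
rewrite !scl_gt0// => gx gy.
have div v (c : R) : (l%:E * v <= c%:E)%E -> (v <= (c / l)%:E)%E.
  case: v => [r||_]; rewrite ?leNye// ?gt0_muley ?lte_fin//.
  by rewrite -EFinM !lee_fin ler_pdivlMr// mulrC.
have le0l : (0 <= l%:E)%E by rewrite lee_fin.
have := g_cvx x y (a / l) (b / l) t t01 (div _ _ gx) (div _ _ gy).
move=> /(lee_wpmul2l le0l)/le_trans; apply.
rewrite -EFinM lee_fin le_eqVlt; apply/orP; left; apply/eqP.
by field; rewrite gt_eqF.
Qed.

(** A real bound on an upper limit holds up to [e] for all large [k], where convexity of [f k]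
    applies. *)
Lemma epi_convex_f_infty (f : nat -> X -> \bar R) :
  (forall k, epi_convex (f k)) -> epi_convex (f_infty f).
Proof.
move=> f_cvx x y a b t t01 fx fy; apply/lee_addgt0Pr => e e_gt0.
have ltD (v : \bar R) (c : R) : (v <= c%:E)%E -> (v < (c + e)%:E)%E.
  by move=> /le_lt_trans; apply; rewrite lte_fin ltrDl.
have [N Nx] := limn_esup_lt _ _ (ltD _ _ fx).
have [N' Ny] := limn_esup_lt _ _ (ltD _ _ fy).
apply: (limn_esup_le _ _ (maxn N N')) => k; rewrite geq_max => /andP[Nk N'k].
have := f_cvx k x y _ _ t t01 (ltW (Nx k Nk)) (ltW (Ny k N'k)).
by congr (_ <= _)%E; rewrite -EFinD; congr EFin; ring.
Qed.

(* A convex function equal to -oo somewhere is -oo along the open segments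
   towards points of its domain. *)
Lemma epi_convex_proper g (xb : X) (U : set X) : epi_convex g ->
  nbhs xb U -> (g xb < +oo)%E -> (forall x, U x -> g x != -oo%E) ->
  forall x, g x != -oo%E.
Proof.
move=> g_cvx xbU /lt_pinfty_le[a gxb] gU y; apply/eqP => gy.
have Ut : \forall t \near (0 : R)^'+, U (t *: y + (1 - t) *: xb).
  suff H : (fun t : R => t *: y + (1 - t) *: xb) t @[t --> 0] --> xb.
    by apply: cvg_within; exact: (H U xbU).
  rewrite -[X in _ --> X](_ : 0 *: y + (1 - 0) *: xb = xb); last first.
    by rewrite scale0r add0r subr0 scale1r.
  apply: cvgD; first by apply: cvgZr_tmp; exact: cvg_id.
  by apply: cvgZr_tmp; apply: cvgB; [exact: cvg_cst|exact: cvg_id].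
near (0 : R)^'+ => t.
have t01 : 0 < t < 1.
  by apply/andP; split; near: t; [exact: nbhs_right_gt|exact: nbhs_right_lt].
have : (g (t *: y + (1 - t) *: xb)%R != -oo)%E by apply: gU; near: t.
apply/negP; rewrite negbK -leeNy_eq leNgt; apply/negP => gt.
have [m gm] : exists m : R, (m%:E < g (t *: y + (1 - t) *: xb)%R)%E.
  case: (g _) gt => // [r|] _; last by exists 0; rewrite ltry.
  by exists (r - 1); rewrite lte_fin; lra.
(* Every real bounds [g y = -oo]; this one makes the convex combination equal to [m], which is
   strictly below the value of [g] there. *)
have := g_cvx y xb ((m - (1 - t) * a) / t) a t t01; rewrite gy leNye => /(_ isT gxb).
rewrite mulrC divfK ?subrK; first by rewrite leNgt gm.
by case/andP: t01 => ? _; rewrite gt_eqF.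
Unshelve. all: end_near.
Qed.

End EpiConvex.

(** * Strong duality under the Slater condition *)

Section Duality.
Context {R : realType} {X : normedModType R}.
Variables (f : nat -> X -> \bar R) (v : R).
Hypothesis f_cvx : forall k, epi_convex (f k).
Hypothesis f_proper : forall k x, f k x != -oo%E.
Hypothesis v_le : forall x, feasible f x -> (v%:E <= f 0%N x)%E.

(** Exact penalization: [K] is the excess [b - v] of the objective bound at the Slater point,
    divided by the slack [sg] of the constraints there. When the supremum of the constraints is
    [-oo], the slack 1 is taken. *)
Lemma slater_penalty : slater f -> exists2 K : R, 0 <= K &
  forall x (a s : R), 0 <= s -> (f 0%N x <= a%:E)%E ->
    (forall k, (f k.+1 x <= s%:E)%E) -> v <= a + K * s.
Proof.
move=> [xs [/lt_pinfty_le[b f0xs] sup_lt0]].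
have [sg sg_gt0 fxs] : exists2 sg : R, 0 < sg & forall k, (f k.+1 xs <= (- sg)%:E)%E.
  have f_sup k : (f k.+1 xs <= ereal_sup [set f k xs | k in [set k | (0 < k)%N]])%E.
    by apply: ereal_sup_ubound; exists k.+1.
  case: (ereal_sup _) sup_lt0 f_sup => [r|//|] r_lt0 f_sup.
    by exists (- r) => [|k]; rewrite ?opprK ?oppr_gt0.
  by exists 1 => // k; apply: le_trans (f_sup k) _; rewrite leNye.
have vb : v <= b.
  rewrite -lee_fin (le_trans _ f0xs)//; apply: v_le; split.
    exact: le_lt_trans f0xs (ltry _).
  move=> [//|k] _; apply: le_trans (fxs k) _.
  by rewrite lee_fin oppr_le0 ltW.
exists ((b - v) / sg); first by rewrite divr_ge0 ?subr_ge0// ltW.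
move=> x a s s_ge0 f0x fx.
(* The convex combination of [x] and the Slater point with weights [sg] and
   [s] is feasible. *)
have [s_gt0|s_le0] := ltP 0 s; last first.
  have s0 : s = 0 by apply/eqP; rewrite eq_le s_le0.
  rewrite s0 mulr0 addr0 -lee_fin (le_trans _ f0x)//; apply: v_le; split.
    exact: le_lt_trans f0x (ltry _).
  by move=> [//|k] _; have := fx k; rewrite s0.
have sg_neq0 : sg != 0 by exact: lt0r_neq0.
have sgs_neq0 : sg + s != 0 by apply: lt0r_neq0; exact: addr_gt0.
pose t := sg / (sg + s).
have t01 : 0 < t < 1.
  by rewrite /t divr_gt0 ?addr_gt0//= ltr_pdivrMr ?addr_gt0// mul1r; lra.
have tE : 1 - t = s / (sg + s) by rewrite /t; field.
have le_v : (v%:E <= (t * a + (1 - t) * b)%:E)%E.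
  apply: le_trans (f_cvx 0 x xs a b t t01 f0x f0xs); apply: v_le; split.
    exact: le_lt_trans (f_cvx 0 x xs a b t t01 f0x f0xs) (ltry _).
  move=> [//|k] _; apply: le_trans (f_cvx _ _ _ _ _ t t01 (fx k) (fxs k)) _.
  rewrite lee_fin tE /t le_eqVlt; apply/orP; left; apply/eqP; by field.
move: le_v; rewrite lee_fin tE /t => le_v.
have q_ge0 : 0 <= (sg + s) / sg by rewrite divr_ge0// ?addr_ge0// ltW.
have := ler_wpM2r q_ge0 le_v.
have -> : (sg / (sg + s) * a + s / (sg + s) * b) * ((sg + s) / sg) =
    a + s * b / sg by field; rewrite sg_neq0.
have -> : v * ((sg + s) / sg) = v + s * v / sg by field.
have -> : (b - v) / sg * s = s * b / sg - s * v / sg by field.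
lra.
Qed.

(** [E z a] says that some point satisfies the constraints relaxed to [z] with objective at most
    [v + a]. The penalty estimate is the hypothesis of [sequence_multipliers] for [E], and the part
    of the mass [L] not carried by the unit vectors becomes the multiplier of [f_infty]. *)
Lemma strong_duality xb : slater f -> f 0%N xb = v%:E -> feasible f xb ->
  exists (l : nat -> R) (linf : R), D_adm l linf /\
    forall x, (v%:E <= D_obj f l linf x)%E.
Proof.
move=> /slater_penalty[K K_ge0 KP] f0xb [_ fxb].
pose E (z : @bddseq R) (a : R) :=
  exists x, (f 0%N x <= (v + a)%:E)%E /\ forall k, (f k.+1 x <= (z k)%:E)%E.
have [||//||l [L [l_ge0 l_le lP]]] := sequence_multipliers E K.
- move=> z a w b t t01 [x [f0x fx]] [y [f0y fy]].
  exists (t *: x + (1 - t) *: y); split=> [|k]; last exact: f_cvx.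
  have := f_cvx 0 x y _ _ t t01 f0x f0y; congr (_ <= _)%E; congr EFin; ring.
- exists xb; split=> [|k]; first by rewrite f0xb addr0.
  exact: fxb.
- move=> z a [x [f0x fx]]; have := KP x (v + a) (pos_sup z).
  have z_ge0 : 0 <= pos_sup z.
    by have := pos_sup_ub z 0; rewrite ge_max => /andP[].
  have z_le k : (f k.+1 x <= (pos_sup z)%:E)%E.
    apply: le_trans (fx k) _; rewrite lee_fin.
    by have := pos_sup_ub z k; rewrite ge_max => /andP[].
  by move=> /(_ z_ge0 f0x z_le); lra.
(* Entry [k] of a sequence belongs to the constraint [f k.+1]; index 0 is the objective and gets the
   dummy value 0. *)
pose l' k := if k is k'.+1 then l k' else 0.
have l'_ge0 k : 0 <= l' k by case: k.
have seriesS n : series l' n.+1 = \sum_(k < n) l k.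
  by rewrite /series/= big_nat_recl//= add0r big_mkord.
have series_nd : nondecreasing_seq (series l').
  by apply: nondecreasing_series.
have series_le n : series l' n <= L.
  apply: le_trans (_ : series l' n.+1 <= L); first exact: series_nd.
  by rewrite seriesS.
have cvg_l' : cvgn (series l').
  apply: nondecreasing_is_cvgn => //; exists L => _ [n _ <-]; exact: series_le.
pose S := limn (series l').
have S_le : S <= L by apply: limr_le => //; near=> n; exact: series_le.
exists l', (L - S); split; first by split=> //; split=> //; rewrite subr_ge0.
move=> x; rewrite /D_obj; set P := limn_esup _.
have [f0x|] := eqVneq (f 0%N x) +oo%E; first by rewrite f0x !daddye leey.
case f0x : (f 0%N x) => [a|//|] _; last by have := f_proper 0 x; rewrite f0x.
have [finf|finf_neq] := eqVneq (f_infty f x) +oo%E.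
  by rewrite finf scl_pinfty ?subr_ge0// daddey leey.
have [[k0 fk0]|fx] := pselect (exists k, f k.+1 x = +oo%E).
  suff -> : P = +oo%E by rewrite daddey daddye leey.
  apply/eqP; rewrite -leye_eq; apply: limn_esup_ge => N.
  exists (maxn N k0.+1); rewrite ?leq_maxl// (dsum_pinfty _ _ _ k0.+1)//.
    by rewrite mem_index_iota /= ltnS leq_maxr.
  by rewrite fk0 scl_pinfty.
pose F k := fine (f k.+1 x).
have FE k : f k.+1 x = (F k)%:E.
  rewrite /F fineK// fin_numE f_proper/=; apply/eqP => fk; apply: fx; by exists k.
(* The values [F k] may be unbounded below, so the sequence inserted into [lP] is cut at [n] and
   continued by [c], which dominates them from there on. As [n] grows, the tail mass tends to
   [L - S]. *)
have P_ge (c : R) : (f_infty f x < c%:E)%E -> ((v - a - c * (L - S))%:E <= P)%E.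
  move=> /limn_esup_lt[N0 fN0].
  apply/lee_subgt0Pr => e e_gt0; apply: limn_esup_ge => N.
  have [N1 _ N1P] : \forall n \near \oo, c * (L - series l' n) < c * (L - S) + e.
    have : c * (L - series l' n) @[n --> \oo] --> c * (L - S).
      by apply: cvgMr; apply: cvgB => //; exact: cvg_cst.
    by move=> /cvgr_lt; apply; lra.
  pose n := maxn N (maxn N0 N1).
  have Nn : (N <= n)%N by exact: leq_maxl.
  have N0n : (N0 <= n)%N by rewrite /n !leq_max leqnn orbT.
  have N1n : (N1 <= n)%N by rewrite /n !leq_max leqnn !orbT.
  exists n => //.
  have zb : (fun k => if (k < n)%N then F k else c) \in bounded_seq.
    apply/asboolP; exists (\sum_(k < n) `|F k| + `|c|) => k; case: ifPn => kn.
      rewrite (bigD1 (Ordinal kn))//= -addrA lerDl addr_ge0// sumr_ge0//.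
    by rewrite lerDr sumr_ge0.
  have Ez : E (Bddseq _ zb) (a - v).
    exists x; split=> [|k] /=; first by rewrite f0x addrC subrK.
    case: ifPn => kn; first by rewrite FE.
    by apply/ltW/fN0; rewrite (leq_trans N0n)// leqW// leqNgt.
  have zc k : (n <= k)%N -> Bddseq _ zb k <= c by move=> nk /=; rewrite ltnNge nk.
  have := lP _ _ c n Ez zc; rewrite /=.
  rewrite (dsum_EFin _ _ _ (fun k => if k is k'.+1 then l k' * F k' else 0)); last first.
    by move=> [|k]; rewrite mem_index_iota// => _; rewrite FE scl_EFin.
  rewrite big_add1/= big_mkord -seriesS -EFinB lee_fin.
  have -> : \sum_(k < n) (if (k < n)%N then F k else c) * l k = \sum_(k < n) l k * F k.
    by apply: eq_bigr => i _; rewrite ltn_ord mulrC.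
  have := N1P n.+1 (leqW N1n); lra.
(* For a finite value [r], let [c] decrease to [r]; the summand 1 in the denominator covers
   [L = S]. *)
case finfE : (f_infty f x) finf_neq P_ge => [r|//|] _ P_ge.
  have : ((v - a - r * (L - S))%:E <= P)%E.
    apply/lee_subgt0Pr => e e_gt0.
    have d_gt0 : 0 < e / (L - S + 1) by rewrite divr_gt0// ltr_wpDl// subr_ge0.
    apply: le_trans (P_ge (r + e / (L - S + 1)) _); last by rewrite lte_fin; lra.
    rewrite -EFinB lee_fin.
    have : e / (L - S + 1) * (L - S) <= e.
      rewrite mulrAC ler_pdivrMr; last lra.
      by rewrite ler_wpM2l ?ltW//; lra.
    lra.
  rewrite scl_EFin; clear P_ge; case: P => [p||]; rewrite ?leey//.
  by rewrite -!dEFinD !lee_fin; lra.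
have [LS|LS] := eqVneq (L - S) 0.
  have := P_ge 0 (ltNyr _); rewrite LS scl0//; clear P_ge.
  case: P => [p||]; rewrite ?leey// -!dEFinD !lee_fin; lra.
have LS_gt0 : 0 < L - S by rewrite lt_def LS subr_ge0.
(* Here [f_infty f x = -oo] has a positive multiplier. Since [c] may be any real, [P = +oo], and
   dual addition lets [+oo] win. *)
suff -> : P = +oo%E by rewrite daddey daddye leey.
apply/eqyP => A A_gt0; have := P_ge ((v - a - A) / (L - S)) (ltNyr _).
by rewrite divfK// opprB addrC subrK.
Unshelve. all: end_near.
Qed.

End Duality.

(** * The fuzzy sum rule *)

Lemma near_all_seq (T : Type) (F : set_system T) (I : eqType) (s : seq I)
    (P : I -> T -> Prop) : Filter F ->
  (forall i, i \in s -> \forall x \near F, P i x) ->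
  \forall x \near F, forall i, i \in s -> P i x.
Proof.
move=> FF; elim: s => [|j s IH] FP; first by near=> x.
have FPj := FP j (mem_head j s).
have {}IH : \forall x \near F, forall i, i \in s -> P i x.
  by apply: IH => i si; apply: FP; rewrite in_cons si orbT.
by apply: filterS2 FPj IH => x Pj Ps i; rewrite in_cons => /predU1P[->//|]; exact: Ps.
Unshelve. all: end_near.
Qed.

(** * Max-norm and spread of finite families of points *)

Section ProductSeminorms.
Context {R : realType} {X : normedModType R} {I : eqType}.
Variables (s : seq I) (t0 : I).
Implicit Types (x y z : I -> X).

Definition max_norm z : R := \big[Num.max/0]_(t <- s) `|z t|.
Definition spread z : R := \sum_(t <- s) `|z t - z t0|.

Lemma max_norm_ge t z : t \in s -> `|z t| <= max_norm z.
Proof. by move=> st; apply: (le_bigmax_seq _ t). Qed.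

Lemma max_norm_ge0 z : 0 <= max_norm z.
Proof. exact: bigmax_ge_id. Qed.

Lemma max_norm_le z (e : R) : 0 <= e -> (forall t, t \in s -> `|z t| <= e) ->
  max_norm z <= e.
Proof. by move=> e_ge0 ze; rewrite /max_norm big_seq; apply: bigmax_le. Qed.

Lemma max_norm_lt z (e : R) : 0 < e -> (forall t, t \in s -> `|z t| < e) ->
  max_norm z < e.
Proof. by move=> e_gt0 ze; rewrite /max_norm big_seq; apply: bigmax_lt. Qed.

Lemma max_normD x y : max_norm (x + y) <= max_norm x + max_norm y.
Proof.
apply: max_norm_le => [|t st]; first by rewrite addr_ge0 ?max_norm_ge0.
by apply: le_trans (ler_normD _ _) _; rewrite lerD ?max_norm_ge.
Qed.

Lemma max_normZ (a : R) z : max_norm (a *: z) <= `|a| * max_norm z.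
Proof.
apply: max_norm_le => [|t st]; first by rewrite mulr_ge0 ?max_norm_ge0.
by rewrite normrZ ler_wpM2l// max_norm_ge.
Qed.

Lemma max_normN z : max_norm (- z) = max_norm z.
Proof. by apply: eq_bigr => t _; rewrite normrN. Qed.

Lemma max_norm0 : max_norm 0 = 0.
Proof.
apply/eqP; rewrite eq_le max_norm_ge0 andbT.
by apply: max_norm_le => // t _; rewrite normr0.
Qed.

Lemma spread_ge0 z : 0 <= spread z.
Proof. exact: sumr_ge0. Qed.

Lemma spread_ge t z : t \in s -> `|z t - z t0| <= spread z.
Proof.
by move=> st; rewrite /spread (big_rem t)//= lerDl sumr_ge0.
Qed.

Lemma spreadD x y : spread (x + y) <= spread x + spread y.
Proof.
rewrite /spread -big_split/=; apply: ler_sum => t _.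
by apply: le_trans (ler_normD _ _); rewrite opprD addrACA.
Qed.

Lemma spreadZ (a : R) z : spread (a *: z) = `|a| * spread z.
Proof.
rewrite /spread mulr_sumr; apply: eq_bigr => t _.
by rewrite -[LHS]/(`|a *: z t - a *: z t0|) -scalerBr normrZ.
Qed.

Lemma spreadN z : spread (- z) = spread z.
Proof. by rewrite -scaleN1r spreadZ normrN1 mul1r. Qed.

Lemma spread_le_max_norm z : t0 \in s ->
  spread z <= (2 * size s)%:R * max_norm z.
Proof.
move=> st0; apply: le_trans (_ : \sum_(t <- s) (2 * max_norm z) <= _).
  rewrite /spread big_seq [leRHS]big_seq; apply: ler_sum => t st.
  apply: le_trans (ler_normB _ _) _.
  by have := max_norm_ge t z st; have := max_norm_ge t0 z st0; lra.
rewrite -[leLHS]/(\sum_(t <- s) _) big_const_seq count_predT iter_addr_0.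
by rewrite natrM -mulr_natr; lra.
Qed.

Lemma cvg_max_norm (u : nat -> I -> X) x :
  (forall e, 0 < e -> \forall n \near \oo, max_norm (u n - x) < e) ->
  forall t, t \in s -> u n t @[n --> \oo] --> x t.
Proof.
move=> ux t st; apply/cvgrPdist_lt => e /ux; apply: filterS => n.
by apply: le_lt_trans; rewrite distrC; exact: (max_norm_ge t (u n - x)).
Qed.

End ProductSeminorms.

(** The components on [s] are Cauchy, and finiteness of [s] makes their convergence uniform. *)
Lemma max_norm_complete {R : realType} {X : completeNormedModType R} {I : eqType}
    (s : seq I) (u : nat -> I -> X) :
  (forall e, 0 < e -> exists N, forall m n, (N <= m)%N -> (N <= n)%N ->
     max_norm s (u m - u n) < e) ->
  exists x, forall e, 0 < e -> \forall n \near \oo, max_norm s (u n - x) < e.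
Proof.
move=> u_cauchy.
have u_cvg t : t \in s -> cvg (u n t @[n --> \oo]).
  move=> st; apply/cauchy_cvgP/cauchy_exP => e e_gt0.
  have [N NP] := u_cauchy e e_gt0; exists (u N t), N => // n /= Nn.
  rewrite -ball_normE/=; apply: le_lt_trans (NP N n (leqnn N) Nn).
  exact: (max_norm_ge s t (u N - u n)).
exists (fun t => lim (u n t @[n --> \oo])) => e e_gt0.
have := near_all_seq _ \oo _ s (fun t n => `|u n t - lim (u n t @[n --> \oo])| < e) _.
move=> H; have : \forall n \near \oo, forall t, t \in s ->
    `|u n t - lim (u n t @[n --> \oo])| < e.
  apply: H => t st; have /cvgrPdist_lt/(_ e e_gt0) := u_cvg t st.
  by apply: filterS => n; rewrite distrC.
by apply: filterS => n; exact: max_norm_lt.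
Qed.

(** * Minimizing the decoupled sum and splitting the minimality condition *)

Section FuzzySum.
Context {R : realType} {X : completeNormedModType R} {I : eqType}.
Variables (s : seq I) (t0 : I) (g : I -> X -> \bar R) (xb : X) (r : R).
Hypotheses (s_uniq : uniq s) (st0 : t0 \in s).
Hypothesis g_cvx : forall t, epi_convex (g t).
Hypothesis g_proper : forall t x, g t x != -oo%E.
Hypothesis g_lsc : forall t x, `|x - xb| <= r -> lsc_at (g t) x.
Hypothesis g_lb : forall t, exists m : R, forall x, `|x - xb| <= r -> (m%:E <= g t x)%E.

Let A := [set x : I -> X |
  forall t, t \in s -> `|x t - xb| <= r /\ (g t (x t) < +oo)%E].
Let gamma x t := fine (g t (x t)).

Let gammaE x t : A x -> t \in s -> g t (x t) = (gamma x t)%:E.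
Proof. by move=> Ax st; rewrite fineK// fin_numE g_proper lt_eqF//; exact: (Ax t st).2. Qed.

Let phi (K : R) x := \sum_(t <- s) gamma x t + K * spread s t0 x.

Let phi_lsc (K : R) (u : nat -> I -> X) x (c : R) : 0 <= K ->
  (forall n, A (u n)) ->
  (forall e, 0 < e -> \forall n \near \oo, max_norm s (u n - x) < e) ->
  (\forall n \near \oo, phi K (u n) <= c) -> A x /\ phi K x <= c.
Proof.
move=> K_ge0 Au ux uc; have [m mP] := choice g_lb.
have ux_t := cvg_max_norm s u x ux.
have xr t : t \in s -> `|x t - xb| <= r.
  move=> st; have u_norm : `|u n t - xb| @[n --> \oo] --> `|x t - xb|.
    by apply: cvg_norm; apply: cvgB; [exact: ux_t|exact: cvg_cst].
  by apply: (cvgr_to_le u_norm); near=> n; exact: (Au n t st).1.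
have Ax : A x.
  move=> t st; split; first exact: xr.
  rewrite ltNge leye_eq; apply/negP => /eqP gx.
  (* The other terms are at least their lower bounds [m i] and the penalty is nonnegative, so
     [phi K (u n) <= c] keeps the [t]-th term at most [B]. An infinite value at the limit would
     force it above [B]. *)
  pose B := c - \sum_(i <- rem t s) m i.
  have Bg : (B%:E < g t (x t))%E by rewrite gx ltry.
  have uB : \forall n \near \oo, (B%:E < g t (u n t))%E.
    exact: (ux_t t st _ (g_lsc t _ (xr t st) _ Bg)).
  near \oo => n.
  have : (B%:E < g t (u n t))%E by near: n.
  rewrite (gammaE _ _ (Au n) st) lte_fin ltNge => /negP; apply.
  have : phi K (u n) <= c by near: n.
  rewrite /phi (big_rem t)//= /B.
  have : \sum_(i <- rem t s) m i <= \sum_(i <- rem t s) gamma (u n) i.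
    rewrite big_seq [leRHS]big_seq; apply: ler_sum => i /mem_rem si.
    by rewrite -lee_fin -gammaE//; apply: mP; exact: (Au n i si).1.
  have := mulr_ge0 K_ge0 (spread_ge0 s t0 (u n)); lra.
split=> //; apply/ler_addgt0Pr => e e_gt0.
pose n_s : R := (size s)%:R.
have n_s_ge0 : 0 <= n_s by [].
(* Semicontinuity loses [d] in each term and the penalty at most [K * (2 * n_s) * d], altogether at
   most [e]. *)
pose d := e / (n_s + K * (2 * n_s) + 1).
have D_gt0 : 0 < n_s + K * (2 * n_s) + 1.
  by rewrite ltr_wpDl// addr_ge0// mulr_ge0// mulr_ge0.
have d_gt0 : 0 < d by rewrite divr_gt0.
have dE : d * (n_s + K * (2 * n_s) + 1) = e by rewrite divfK// gt_eqF.
have g_near : \forall n \near \oo, forall t, t \in s -> gamma x t - d < gamma (u n) t.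
  apply: near_all_seq => t st.
  have dg : ((gamma x t - d)%:E < g t (x t))%E.
    by rewrite gammaE// lte_fin ltrBlDr ltrDl.
  have : \forall n \near \oo, ((gamma x t - d)%:E < g t (u n t))%E.
    exact: (ux_t t st _ (g_lsc t _ (xr t st) _ dg)).
  by apply: filterS => n; rewrite (gammaE _ _ (Au n) st) lte_fin.
near \oo => n.
have un_c : phi K (u n) <= c by near: n.
have un_x : max_norm s (u n - x) < d by near: n; exact: ux.
have un_g : forall t, t \in s -> gamma x t - d < gamma (u n) t by near: n.
have sum_g : \sum_(t <- s) gamma x t - n_s * d <= \sum_(t <- s) gamma (u n) t.
  apply: le_trans (_ : \sum_(t <- s) (gamma x t - d) <= _).
    rewrite big_split/= big_const_seq count_predT iter_addr_0 -mulr_natl; lra.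
  by rewrite big_seq [leRHS]big_seq; apply: ler_sum => t st; exact/ltW/un_g.
have spr : spread s t0 x <= spread s t0 (u n) + 2 * n_s * d.
  have xE : x = u n + - (u n - x) by rewrite opprB addrC subrK.
  have := spreadD s t0 (u n) (- (u n - x)); rewrite -xE spreadN => /le_trans; apply.
  rewrite lerD2l; have := spread_le_max_norm s t0 (u n - x) st0.
  rewrite natrM => /le_trans; apply.
  by apply: ler_wpM2l; [exact: mulr_ge0|exact: ltW].
have := ler_wpM2l K_ge0 spr; move: un_c; rewrite /phi -dE; lra.
Unshelve. all: end_near.
Qed.

(** For a suitable [K], the constant family [xb] minimizes [phi K] over [A] up to [eta ^+ 2].
    Ekeland's principle with slope [eta] then moves it by at most [eta]. *)
Let approx_minimizer (c : I -> R) (eta delta : R) :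
  (forall t, t \in s -> g t xb = (c t)%:E) -> 0 <= r -> 0 < eta -> 0 < delta ->
  (forall x : I -> X, (forall t, t \in s -> `|x t - xb| <= r) ->
     (forall t u, t \in s -> u \in s -> `|x t - x u| < delta) ->
     ((\sum_(t <- s) c t - eta ^+ 2)%:E <= \sum_(t <- s) g t (x t))%dE) ->
  exists (K : R) x, [/\ 0 <= K, A x, forall t, t \in s -> `|x t - xb| <= eta,
    \sum_(t <- s) gamma x t <= \sum_(t <- s) c t &
    forall z, A z -> phi K x <= phi K z + eta * max_norm s (x - z)].
Proof.
move=> gxb r_ge0 eta_gt0 delta_gt0 g_close; have [m mP] := choice g_lb.
(* At spread [delta / 2] or more, the penalty alone lifts the lower bound [\sum m] up to [\sum c].
   At smaller spread, any two components are closer than [delta], because both are within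
   [delta / 2] of the component [t0], and [g_close] applies. *)
pose K := 2 * `|\sum_(t <- s) c t - \sum_(t <- s) m t| / delta.
have K_ge0 : 0 <= K by rewrite divr_ge0 ?mulr_ge0// ltW.
have phi_ge x : A x -> \sum_(t <- s) c t - eta ^+ 2 <= phi K x.
  move=> Ax; rewrite /phi.
  have [close|far] := ltP (spread s t0 x) (delta / 2).
    have /g_close : forall t, t \in s -> `|x t - xb| <= r by move=> t /Ax[].
    have x_close t u : t \in s -> u \in s -> `|x t - x u| < delta.
      move=> st su; rewrite -(subrK (x t0) (x t)) -addrA.
      apply: le_lt_trans (ler_normD _ _) _.
      have := spread_ge s t0 t x st; have := spread_ge s t0 u x su.
      by rewrite (distrC (x u)); lra.
    move=> /(_ x_close); rewrite (dsum_EFin _ _ _ (gamma x)) => [|t st]; last exact: gammaE.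
    by rewrite lee_fin; have := mulr_ge0 K_ge0 (spread_ge0 s t0 x); lra.
  have := ler_wpM2l K_ge0 far.
  have -> : K * (delta / 2) = `|\sum_(t <- s) c t - \sum_(t <- s) m t|.
    by rewrite /K; field; exact: lt0r_neq0.
  have := ler_norm (\sum_(t <- s) c t - \sum_(t <- s) m t).
  have : \sum_(t <- s) m t <= \sum_(t <- s) gamma x t.
    rewrite big_seq [leRHS]big_seq; apply: ler_sum => t st.
    by rewrite -lee_fin -gammaE//; apply: mP; have [] := Ax t st.
  have := sqr_ge0 eta; lra.
pose x0 : I -> X := fun=> xb.
have Ax0 : A x0.
  by move=> t st; rewrite /x0 subrr normr0 gxb// ltry.
have phix0 : phi K x0 = \sum_(t <- s) c t.
  rewrite /phi (_ : spread s t0 x0 = 0) ?mulr0 ?addr0; last first.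
    by rewrite /spread big1// => t _; rewrite /x0 subrr normr0.
  by rewrite big_seq [RHS]big_seq; apply: eq_bigr => t st; rewrite /gamma /x0 gxb.
have [|||||||x [Ax x_le x_min]] :=
  @ekeland R (I -> X) (fun x y => max_norm s (x - y)) A (phi K) _ _ _ _ _ _ _ x0 eta Ax0 eta_gt0.
- by move=> x y; exact: max_norm_ge0.
- by move=> x; rewrite subrr max_norm0.
- by move=> x y; rewrite -opprB max_normN.
- move=> x y z; rewrite -[x - z](_ : (x - y) + (y - z) = _); first exact: max_normD.
  by rewrite addrA subrK.
- by move=> u _; exact: max_norm_complete.
- by move=> u x c'; exact: phi_lsc.
- by exists (\sum_(t <- s) c t - eta ^+ 2).
exists K, x; split=> //.
- move=> t st; apply: le_trans (_ : max_norm s (x0 - x) <= _).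
    by rewrite distrC; exact: (max_norm_ge s t (x0 - x)).
  by rewrite -(ler_pM2l eta_gt0) -expr2; have := phi_ge x Ax; rewrite phix0 in x_le; lra.
- have := mulr_ge0 (ltW eta_gt0) (max_norm_ge0 s (x0 - x)).
  have := mulr_ge0 K_ge0 (spread_ge0 s t0 x).
  by move: x_le; rewrite phix0 /phi; lra.
Qed.

(** The sandwich theorem separates the epigraph [E] of the increments of the decoupled sum at [x]
    from [H], the increment of the penalty plus the Ekeland term. *)
Let subgradients (K eta : R) x : 0 <= K -> 0 < eta -> eta < r -> A x ->
  (forall t, t \in s -> `|x t - xb| <= eta) ->
  (forall z, A z -> phi K x <= phi K z + eta * max_norm s (x - z)) ->
  exists psi : (I -> X) -> R, [/\ linear_form psi,
    forall z (al : I -> R),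
      (forall t, t \in s -> (g t (x t + z t)%R <= (al t)%:E)%E) ->
      psi z <= \sum_(t <- s) al t - \sum_(t <- s) gamma x t &
    forall z, `|psi z| <= K * spread s t0 z + eta * max_norm s z].
Proof.
move=> K_ge0 eta_gt0 eta_r Ax x_eta x_min.
pose E (z : I -> X) (a : R) := exists2 al : I -> R,
  (forall t, t \in s -> (g t (x t + z t)%R <= (al t)%:E)%E) &
  a = \sum_(t <- s) al t - \sum_(t <- s) gamma x t.
pose H z := K * (spread s t0 (x + z) - spread s t0 x) + eta * max_norm s z.
have comb (t : R) (y z w : X) : y + (t *: z + (1 - t) *: w) =
    t *: (y + z) + (1 - t) *: (y + w).
  by rewrite !scalerDr addrACA -scalerDl (addrC t) subrK scale1r.
have combf (t : R) (y z w : I -> X) : y + (t *: z + (1 - t) *: w) =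
    t *: (y + z) + (1 - t) *: (y + w) by apply/funext => i; exact: comb.
have spread_cvx (t : R) (z w : I -> X) : 0 < t < 1 ->
    spread s t0 (t *: z + (1 - t) *: w) <=
    t * spread s t0 z + (1 - t) * spread s t0 w.
  move=> /andP[t_gt0 t_lt1]; apply: le_trans (spreadD _ _ _ _) _.
  by rewrite !spreadZ !ger0_norm//; lra.
have norm_cvx (t : R) (z w : I -> X) : 0 < t < 1 ->
    max_norm s (t *: z + (1 - t) *: w) <= t * max_norm s z + (1 - t) * max_norm s w.
  move=> /andP[t_gt0 t_lt1]; apply: le_trans (max_normD _ _ _) _.
  apply: lerD; apply: le_trans (max_normZ _ _ _) _; rewrite ger0_norm//; lra.
have [||||z a [al gal ->]|psi [psi_lin psiE psiH]] := @sandwich R (I -> X) E H.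
- move=> z a w b t t01 [al gal ->] [be gbe ->].
  exists (fun i => t * al i + (1 - t) * be i).
    move=> i si; rewrite -[(_ + _) i]/(t *: z i + (1 - t) *: w i) comb.
    exact: (g_cvx i _ _ _ _ t t01 (gal i si) (gbe i si)).
  by rewrite big_split/= -!mulr_sumr; lra.
- exists (gamma x); last by rewrite subrr.
  by move=> t st; rewrite addr0 gammaE.
- move=> z w t t01; rewrite /H combf.
  have := ler_wpM2l K_ge0 (spread_cvx t (x + z) (x + w) t01).
  have := ler_wpM2l (ltW eta_gt0) (norm_cvx t z w t01).
  lra.
- by rewrite /H addr0 subrr max_norm0 !mulr0 addr0.
(* Minimality is known only within radius [r]. Since [x] stays within [eta < r], the shrunken step
   [t *: z] remains in [A], and convexity carries the inequality back to the full step [z]. *)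
- pose d := r - eta; have d_gt0 : 0 < d by rewrite subr_gt0.
  have D_gt0 : 0 < d + max_norm s z + 1.
    by rewrite ltr_wpDl// addr_ge0 ?max_norm_ge0// ltW.
  pose t := d / (d + max_norm s z + 1).
  have z_ge0 := max_norm_ge0 s z.
  have t01 : 0 < t < 1 by rewrite divr_gt0//= ltr_pdivrMr// mul1r; lra.
  have /andP[t_gt0 t_lt1] := t01.
  have tz : t * max_norm s z <= d.
    by rewrite mulrAC ler_pdivrMr// ler_wpM2l ?ltW//; lra.
  have xtz i : x i + t *: z i = t *: (x i + z i) + (1 - t) *: x i.
    by have := comb t (x i) (z i) 0; rewrite scaler0 !addr0.
  have g_le i : i \in s ->
      (g i (x i + t *: z i)%R <= (t * al i + (1 - t) * gamma x i)%:E)%E.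
    by move=> si; rewrite xtz; apply: g_cvx => //; [exact: gal|rewrite gammaE].
  have Axtz : A (x + t *: z).
    move=> i si; split; last exact: le_lt_trans (g_le i si) (ltry _).
    rewrite -[(x + t *: z) i]/(x i + t *: z i) addrAC.
    apply: le_trans (ler_normD _ _) _; rewrite normrZ (ger0_norm (ltW t_gt0)).
    have := ler_wpM2l (ltW t_gt0) (max_norm_ge s i z si).
    by have := x_eta i si; rewrite /d in tz; lra.
  have := x_min _ Axtz; rewrite opprD addrA subrr sub0r max_normN /phi.
  have := ler_wpM2l (ltW eta_gt0) (max_normZ s t z); rewrite (ger0_norm (ltW t_gt0)).
  have : \sum_(i <- s) gamma (x + t *: z) i <=
      t * (\sum_(i <- s) al i) + (1 - t) * \sum_(i <- s) gamma x i.
    rewrite !mulr_sumr -big_split/= big_seq [leRHS]big_seq; apply: ler_sum => i si.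
    by rewrite -lee_fin -gammaE//; exact: g_le.
  have xtzf : x + t *: z = t *: (x + z) + (1 - t) *: x by apply/funext => i; exact: xtz.
  have := ler_wpM2l K_ge0 (spread_cvx t (x + z) x t01); rewrite -xtzf => *.
  by rewrite -(pmulr_rge0 _ t_gt0) /H; lra.
have psi_le z : psi z <= K * spread s t0 z + eta * max_norm s z.
  apply: le_trans (psiH z) _; rewrite /H max_normN lerD2r ler_wpM2l//.
  by have := spreadD s t0 x (- z); rewrite spreadN; lra.
exists psi; split=> //.
- by move=> z al gal; apply: psiE; exists al.
- move=> z; rewrite ler_norml psi_le andbT.
  have := psi_le (- z); rewrite spreadN max_normN -scaleN1r -[(-1) *: z]addr0 psi_lin.
  by rewrite (linear_form0 _ psi_lin); lra.
Qed.

Let single t (y : X) : I -> X := fun i => if i == t then y else 0.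

(** [p t] is the restriction of [psi] to the [t]-th coordinate. Its norm bound involves [K], but the
    sum of all [p t] at [y] is [psi] at a family constant on [s], where the spread vanishes. *)
Theorem fuzzy_sum_rule (c : I -> R) (eta delta : R) :
  (forall t, t \in s -> g t xb = (c t)%:E) -> 0 < eta -> eta < r -> 0 < delta ->
  (forall x : I -> X, (forall t, t \in s -> `|x t - xb| <= r) ->
     (forall t u, t \in s -> u \in s -> `|x t - x u| < delta) ->
     ((\sum_(t <- s) c t - eta ^+ 2)%:E <= \sum_(t <- s) g t (x t))%dE) ->
  exists (x : I -> X) (b : I -> R) (p : I -> X -> R),
    [/\ forall t, t \in s -> `|x t - xb| <= eta /\ g t (x t) = (b t)%:E,
      \sum_(t <- s) b t <= \sum_(t <- s) c t,
      forall t, t \in s -> linear_form (p t) /\ exists C : R, forall y, `|p t y| <= C * `|y|,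
      forall t y, t \in s -> ((b t + p t y)%:E <= g t (x t + y)%R)%E &
      forall y, `|\sum_(t <- s) p t y| <= eta * `|y|].
Proof.
move=> gxb eta_gt0 eta_r delta_gt0 g_close.
have r_ge0 : 0 <= r by rewrite ltW// (lt_trans eta_gt0).
have [K [x [K_ge0 Ax x_eta x_le x_min]]] :=
  approx_minimizer c eta delta gxb r_ge0 eta_gt0 delta_gt0 g_close.
have [psi [psi_lin psi_g psi_le]] := subgradients K eta x K_ge0 eta_gt0 eta_r Ax x_eta x_min.
have single_lin t (a : R) (y z : X) :
    single t (a *: y + z) = a *: single t y + single t z.
  apply/funext => i; rewrite -[RHS]/(a *: single t y i + single t z i) /single.
  by case: ifP => // _; rewrite scaler0 addr0.
have single_le t i (y : X) : `|single t y i| <= `|y|.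
  by rewrite /single; case: ifP => // _; rewrite normr0.
exists x, (gamma x), (fun t y => psi (single t y)); split=> //.
- by move=> t st; split; [exact: x_eta|exact: gammaE].
- move=> t st; split; first by move=> a y z; rewrite single_lin psi_lin.
  exists (K * (2 * size s)%:R + eta) => y; apply: le_trans (psi_le _) _.
  have z_le : max_norm s (single t y) <= `|y|.
    by apply: max_norm_le => // i _; exact: single_le.
  have := ler_wpM2l (ltW eta_gt0) z_le.
  have := spread_le_max_norm s t0 (single t y) st0.
  have le1 := ler_wpM2l (ler0n R (2 * size s)) z_le; move=> le2.
  by have := ler_wpM2l K_ge0 (le_trans le2 le1); lra.
- move=> t y st; case gy : (g t (x t + y)) => [b||]; last 2 first.
  + by rewrite leey.
  + by have := g_proper t (x t + y); rewrite gy.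
  (* Only the coordinate [t] moves, so all other terms cancel in the difference of sums. *)
  have := psi_g (single t y) (fun i => if i == t then b else gamma x i).
  have g_le : forall i, i \in s ->
      (g i (x i + single t y i)%R <= (if i == t then b else gamma x i)%:E)%E.
    move=> i si; rewrite /single; case: eqP => [->|_]; first by rewrite gy.
    by rewrite addr0 gammaE.
  move=> /(_ g_le); rewrite (bigD1_seq t)//= eqxx [X in _ - X](bigD1_seq t)//=.
  rewrite (eq_bigr (gamma x)) => [|i /negbTE ->//].
  by rewrite lee_fin; lra.
- move=> y; pose z := \sum_(t <- s) 1 *: single t y.
  have -> : \sum_(t <- s) psi (single t y) = psi z.
    by rewrite linear_form_sum//; apply: eq_bigr => t _; rewrite mul1r.
  have zE i : i \in s -> z i = y.
    move=> si; rewrite /z fct_sumE (bigD1_seq i)//= -[(1 *: _) i]/(1 *: single i y i).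
    rewrite scale1r {1}/single eqxx big1 ?addr0// => t ti.
    by rewrite -[(1 *: _) i]/(1 *: single t y i) /single eq_sym (negbTE ti) scaler0.
  apply: le_trans (psi_le z) _.
  have -> : spread s t0 z = 0.
    by rewrite /spread big_seq big1// => t st; rewrite !zE// subrr normr0.
  rewrite mulr0 add0r ler_pM2l//; apply: max_norm_le => // t st.
  by rewrite zE.
Qed.

End FuzzySum.

(** * Application to the dual problem *)

Section Subgradients.
Context {R : realType} {X : normedModType R}.
Implicit Types (p : X -> R) (F : X -> \bar R).

Lemma bounded_dual_elem p (C : R) : linear_form p ->
  (forall y, `|p y| <= C * `|y|) -> dual_elem p.
Proof.
move=> p_lin p_le; split=> // x; apply/cvgrPdist_lt => e e_gt0.
have C1_gt0 : 0 < `|C| + 1 by rewrite ltr_wpDl.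
have : \forall y \near x, `|x - y| < e / (`|C| + 1).
  by apply/nbhs_normP; exists (e / (`|C| + 1)) => //=; exact: divr_gt0.
apply: filterS => y; rewrite ltr_pdivlMr// => xy.
have -> : p x - p y = p (x - y).
  by have := p_lin (-1) y x; rewrite scaleN1r addrC => ->; lra.
apply: le_lt_trans (p_le _) _; apply: le_lt_trans xy; rewrite mulrC.
by apply: ler_wpM2l => //; have := ler_norm C; lra.
Qed.

Lemma subdiff_of_le F x p (b : R) : dual_elem p -> F x = b%:E ->
  (forall y, ((b + p y)%:E <= F (x + y)%R)%E) -> subdiff F x p.
Proof.
move=> p_dual Fx p_le; split=> //; split=> [|y]; first by rewrite Fx ltry.
have := p_le (y - x); rewrite (addrC x) subrK Fx.
by case: (F y) => [c||]; rewrite ?leey//= -?dEFinB !lee_fin; lra.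
Qed.

(** For [l = 0] the scaled function is the indicator of [dom F], whose subgradients are the normals
    to [dom F]; otherwise [p] is divided by [l]. *)
Lemma scaled_subdiff_of_le (l : R) F x p (b : R) : 0 <= l -> dual_elem p ->
  scl l (F x) = b%:E ->
  (forall y, ((b + p y)%:E <= scl l (F (x + y)%R))%E) -> scaled_subdiff l F x p.
Proof.
move=> l_ge0 p_dual Fx p_le; rewrite /scaled_subdiff.
have xDy y : x + (y - x) = y by rewrite addrC subrK.
have domF y : (scl l (F y) < +oo)%E -> (F y < +oo)%E by exact: scl_lt_pinfty.
have [l0|l_neq0] := eqVneq l 0.
  split=> //; split=> [|y Fy]; first by apply: domF; rewrite Fx ltry.
  have Fx_lt : (F x < +oo)%E by apply: domF; rewrite Fx ltry.
  have := p_le (y - x); rewrite xDy l0 scl0//.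
  by move: Fx; rewrite l0 scl0// => -[<-]; rewrite add0r lee_fin.
have l_gt0 : 0 < l by rewrite lt_def l_neq0.
exists (fun y => l^-1 * p y); last by move=> y; rewrite mulrA divff// mul1r.
apply: (subdiff_of_le _ _ _ (b / l)).
- have [p_lin p_cont] := p_dual; split=> [a y z|y]; first by rewrite p_lin; lra.
  by apply: cvgMr; exact: p_cont.
- move: Fx; case: (F x) => [c||].
  + by rewrite scl_EFin => -[<-]; rewrite mulrAC divff// mul1r.
  + by rewrite scl_pinfty.
  + by rewrite scl_gt0// gt0_muleNy// lte_fin.
- move=> y; have := p_le y; case: (F (x + y)) => [c||]; rewrite ?leey//.
  + rewrite scl_EFin !lee_fin => bc.
    by rewrite mulrC -mulrDr ler_pdivrMl.
  + by rewrite scl_gt0// gt0_muleNy ?lte_fin.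
Qed.

End Subgradients.

(** * Finite heads [0, 1, ..., n, oo] of the index set *)

Definition head_indices n : seq (option nat) :=
  Some 0%N :: rcons [seq Some k | k <- index_iota 1 n.+1] None.

Lemma head_indices_uniq n : uniq (head_indices n).
Proof.
rewrite /= rcons_uniq map_inj_uniq ?iota_uniq ?andbT; last by move=> ? ? [].
rewrite mem_rcons in_cons/= mem_map; last by move=> ? ? [].
by rewrite mem_index_iota/=; apply/mapP => -[].
Qed.

Lemma mem_head_indices n t :
  (t \in head_indices n) = if t is Some k then (k <= n)%N else true.
Proof.
rewrite in_cons mem_rcons in_cons; case: t => [k|]; last by rewrite orbT.
rewrite mem_map; last by move=> ? ? [].
rewrite mem_index_iota ltnS; case: k => [//|k]; exact: orFb.
Qed.

Lemma sum_head_indices (V : nmodType) (F : option nat -> V) n :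
  \sum_(t <- head_indices n) F t =
  F (Some 0%N) + \sum_(1 <= k < n.+1) F (Some k) + F None.
Proof. by rewrite big_cons big_rcons/= big_map addrA. Qed.

Definition head_fset n : {fset option nat} := [fset t in head_indices n]%fset.

Lemma mem_head_fset n t : (t \in head_fset n) = (t \in head_indices n).
Proof. by apply/imfsetP/idP => [[u ? ->]|tn] //; exists t. Qed.

Lemma sum_head_fset {R : realType} (F : option nat -> \bar R) n :
  (\sum_(t <- head_fset n) F t)%dE = (\sum_(t <- head_indices n) F t)%dE.
Proof.
rewrite (perm_big (head_indices n))//; apply: uniq_perm => [||t].
- exact: fset_uniq.
- exact: head_indices_uniq.
- exact: mem_head_fset.
Qed.

(** Cofinality of the heads, which links limits along finite subsets to ordinary partial sums. *)
Lemma sub_head_fset (S : {fset option nat}) :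
  exists N, forall n, (N <= n)%N -> (S `<=` head_fset n)%fset.
Proof.
exists (\max_(t <- S) odflt 0%N t)%N => n Sn; apply/fsubsetP => t St.
rewrite mem_head_fset mem_head_indices; case: t St => // k Sk.
exact: leq_trans (leq_bigmax_seq (Some k) Sk isT) Sn.
Qed.

Lemma scl_le0 {R : realType} (l : R) (v : \bar R) : 0 <= l -> (v <= 0)%E ->
  (scl l v <= 0)%E.
Proof.
move=> l_ge0 v_le0; rewrite /scl; case: eqP => _.
  by case: v v_le0.
exact: mule_ge0_le0.
Qed.

(** * Consequences of the absence of a duality gap *)

Section Complementarity.
Context {R : realType} {X : normedModType R}.
Variables (f : nat -> X -> \bar R) (l : nat -> R) (linf v : R).
Hypothesis l_ge0 : forall k, 0 <= l k.
Hypothesis linf_ge0 : 0 <= linf.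
Hypothesis D_ge : forall x, (v%:E <= D_obj f l linf x)%E.

(** At [xb] the dual objective is [v] plus two nonpositive terms, yet at least [v]; so both terms
    vanish. *)
Lemma complementarity xb : f 0%N xb = v%:E ->
  (forall k, (0 < k)%N -> (f k xb <= 0)%E) ->
  (forall k, (0 < k)%N -> scl (l k) (f k xb) = 0%E) /\
  scl linf (f_infty f xb) = 0%E.
Proof.
move=> f0xb fxb; have := D_ge xb; rewrite /D_obj f0xb.
have scl_le k : (0 < k)%N -> (scl (l k) (f k xb) <= 0)%E.
  by move=> k_gt0; apply: scl_le0 => //; exact: fxb.
set P := limn_esup _; set Q := scl linf _ => v_le.
have P_le0 : (P <= 0)%E.
  apply: (limn_esup_le _ _ 0) => n _; rewrite big_seq; apply: dsume_le0 => k.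
  by rewrite mem_index_iota => /andP[k_gt0 _]; exact: scl_le.
have Q_le0 : (Q <= 0)%E.
  by apply: scl_le0 => //; apply: (limn_esup_le _ _ 1) => k; exact: fxb.
have [P0 Q0] : P = 0%E /\ Q = 0%E.
  clearbody P Q; case: P P_le0 v_le => [p||]; case: Q Q_le0 => [q||] //.
  by rewrite -!dEFinD !lee_fin => *; split; congr EFin; lra.
(* All summands being nonpositive, each partial sum that includes index [k] is at most its [k]-th
   term, hence so is the upper limit [P = 0]. *)
split=> // k k_gt0; apply/eqP; rewrite eq_le scl_le//= -P0.
apply: (limn_esup_le _ _ k) => n kn.
rewrite (big_rem k)/=; last by rewrite mem_index_iota k_gt0.
apply: gee_dDl; rewrite big_seq; apply: dsume_le0 => i /mem_rem.
by rewrite mem_index_iota => /andP[i_gt0 _]; exact: scl_le.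
Qed.

Let g := gfam f l linf.

Lemma sum_gfam (x : option nat -> X) n :
  (\sum_(t <- head_indices n) g t (x t))%dE =
  (f 0%N (x (Some 0%N)) + \sum_(1 <= k < n.+1) scl (l k) (f k (x (Some k)))
    + scl linf (f_infty f (x None)))%dE.
Proof.
rewrite sum_head_indices; congr (_ + _ + _)%dE.
by rewrite big_nat [RHS]big_nat; apply: eq_bigr => -[].
Qed.

(** By cofinality of the heads, [osum] dominates the upper limit of the partial sums in [D_obj].
    Properness allows the terms of [f 0] and [f_infty] to be moved across that limit. *)
Lemma le_osum x : (forall t, g t x != -oo%E) -> (v%:E <= osum g x)%E.
Proof.
move=> g_proper; apply: le_ereal_inf_tmp => _ [S0 _ <-].
have [N NP] := sub_head_fset S0; rewrite leNgt; apply/negP => sup_lt.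
have sum_lt n : (N <= n)%N ->
    (f 0%N x + \sum_(1 <= k < n.+1) scl (l k) (f k x) + scl linf (f_infty f x)
     <= ereal_sup [set (\sum_(t <- S) g t x)%dE | S in
          [set S : {fset option nat} | (S0 `<=` S)%fset]])%dE.
  move=> Nn; rewrite -(sum_gfam (fun=> x)) -sum_head_fset.
  by apply: ereal_sup_ubound; exists (head_fset n) => //; exact: NP.
have [w [w_lt sup_w]] : exists w : R, w < v /\ forall n, (N <= n)%N ->
    (f 0%N x + \sum_(1 <= k < n.+1) scl (l k) (f k x) + scl linf (f_infty f x)
     <= w%:E)%dE.
  case: (ereal_sup _) sup_lt sum_lt => [w|//|] sup_lt sum_lt.
    by exists w.
  exists (v - 1); split=> [|n Nn]; first by rewrite gtrBl.
  by apply: le_trans (sum_lt n Nn) _; rewrite leNye.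
have := sup_w N (leqnn N); have := D_ge x; rewrite /D_obj.
have := g_proper (Some 0%N); have := g_proper None; rewrite /g/=.
case: (scl linf _) sup_w => [q||//]; last first.
  by move=> sup_w _ _ _; rewrite daddey.
case: (f 0%N x) => [a||//]; last by move=> sup_w _ _ _; rewrite !daddye.
move=> sup_w _ _ v_le _.
have : (limn_esup (fun n => (\sum_(1 <= k < n.+1) scl (l k) (f k x))%dE)
    <= (w - a - q)%:E)%E.
  apply: (limn_esup_le _ _ N) => n /sup_w.
  case: (\sum_(_ <= _ < _) _)%dE => [p||]; rewrite ?leNye//.
  by rewrite -!dEFinD !lee_fin; lra.
case: limn_esup v_le => [p||]// ; rewrite -?dEFinD !lee_fin; lra.
Qed.

End Complementarity.

(** As [v - e] lies strictly below [Lam g U], some [S0] witnesses the lower limit, and for each head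
    containing it some diameter [delta] witnesses the inner limit. *)
Lemma fuzzy_gap {R : realType} {X : normedModType R} (g : option nat -> X -> \bar R)
    (U : set X) (v e : R) : 0 < e -> (v%:E <= Lam g U)%E ->
  exists N, forall n, (N <= n)%N -> exists2 delta : R, 0 < delta &
    forall x : option nat -> X, (forall t, t \in head_indices n -> U (x t)) ->
      (forall t u, t \in head_indices n -> u \in head_indices n ->
         `|x t - x u| < delta) ->
      ((v - e)%:E <= \sum_(t <- head_indices n) g t (x t))%dE.
Proof.
move=> e_gt0 v_le.
have : ((v - e)%:E < Lam g U)%E by apply: lt_le_trans v_le; rewrite lte_fin gtrBl.
move=> /ereal_sup_gt[_ [S0 _ <-] inf_gt]; have [N NP] := sub_head_fset S0.
exists N => n Nn.
have /(lt_le_trans inf_gt) : (ereal_inf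
    [set ereal_sup [set Lam_inner g U S d | d in [set d : R | (0 < d)%R]] | S in
      [set S : {fset option nat} | (S0 `<=` S)%fset]] <=
    ereal_sup [set Lam_inner g U (head_fset n) d | d in [set d : R | (0 < d)%R]])%E.
  by apply: ereal_inf_lbound; exists (head_fset n) => //; exact: NP.
move=> /ereal_sup_gt[_ [d /= d_gt0 <-] d_lt]; exists d => // x xU xd.
apply/ltW/(lt_le_trans d_lt); apply: ereal_inf_lbound.
exists x; last exact: sum_head_fset.
split=> [t|t u]; rewrite !mem_head_fset; [exact: xU|exact: xd].
Qed.

Theorem theorem4p1 (R : realType) (X : completeNormedModType R)
  (f : nat -> X -> \bar R) (xb : X) (l : nat -> R) (linf : R) :
  (forall k, proper_fun (f k)) ->
  (forall k, convex_fun (f k)) ->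
  feasible f !=set0 ->
  P_solution f xb ->
  slater f ->
  D_solution f l linf ->
  (* (i) *)
  (exists U : set X, open U /\ U xb /\
     forall t : option nat,
       (forall x, U x -> lsc_at (gfam f l linf t) x) /\
       bounded_below_on (gfam f l linf t) U) ->
  (* (ii) *)
  (exists U : set X, nbhs xb U /\ unif_lsc (gfam f l linf) U) ->
  ((forall k, (0 < k)%N -> scl (l k) (f k xb) = 0%E) /\
   scl linf (f_infty f xb) = 0%E) /\
  forall eps M : R, 0 < eps -> 0 < M ->
  exists n : nat, M < n%:R /\
  exists (xs : nat -> X) (xinf : X),
    (forall k, (k <= n)%N -> ball xb eps (xs k)) /\ ball xb eps xinf /\
    ((f 0%N (xs 0%N) + \sum_(1 <= k < n.+1) scl (l k) (f k (xs k))
       + scl linf (f_infty f xinf))%dE <= f 0%N xb)%E /\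
    exists (p0 : X -> R) (ps : nat -> X -> R) (pinf : X -> R),
      subdiff (f 0%N) (xs 0%N) p0 /\
      (forall k, (1 <= k <= n)%N -> scaled_subdiff (l k) (f k) (xs k) (ps k)) /\
      scaled_subdiff linf (f_infty f) xinf pinf /\
      dual_norm_lt (fun y => p0 y + \sum_(1 <= k < n.+1) ps k y + pinf y) eps.
Proof.
move=> f_proper f_cvx0 _ [xb_feas xb_min] f_slater [[l_ge0 [l_cvg linf_ge0]] D_max]
  [U [U_open [Uxb gU]]] [W [W_nbhs g_ulsc]].
have f_cvx k : epi_convex (f k) by apply: convex_fun_epi.
have f_neqNy k x : f k x != -oo%E by exact: (f_proper k).1.
have [v f0xb] : exists v : R, f 0%N xb = v%:E.
  have := xb_feas.1; have := f_neqNy 0%N xb.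
  by case: (f 0%N xb) => // v; exists v.
(* The given pair is dual optimal, so its dual value is at least that of the multipliers from
   [strong_duality], hence at least [v]. *)
have D_ge x : (v%:E <= D_obj f l linf x)%E.
  have v_min y : feasible f y -> (v%:E <= f 0%N y)%E.
    by rewrite -f0xb; exact: xb_min.
  have [l' [linf' [adm' D_ge']]] :=
    strong_duality f v f_cvx f_neqNy v_min xb f_slater f0xb xb_feas.
  apply: le_trans (_ : D_val f l linf <= _)%E; last first.
    by apply: ereal_inf_lbound; exists x.
  rewrite D_max; apply: le_ereal_sup_tmp; exists (D_val f l' linf').
    by exists (l', linf').
  by apply: le_ereal_inf_tmp => _ [y _ <-]; exact: D_ge'.
have [scl0_k scl0_inf] := complementarity f l linf v l_ge0 linf_ge0 D_ge xb f0xb xb_feas.2.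
split=> // eps M eps_gt0 M_gt0.
pose g := gfam f l linf.
pose c (t : option nat) : R := if t is Some 0%N then v else 0.
have gxb t : g t xb = (c t)%:E by case: t => [[|k]|]//=; exact: scl0_k.
have g_cvx t : epi_convex (g t).
  case: t => [[|k]|] /=; [exact: f_cvx|exact: epi_convex_scl|].
  by apply: epi_convex_scl => //; exact: epi_convex_f_infty.
(* The lower bounds in (i) exclude [-oo] on [U]; convexity extends this to all of [X], as needed for
   [le_osum] on [W]. *)
have g_proper t x : g t x != -oo%E.
  have [_ [m gm]] := gU t.
  apply: (epi_convex_proper _ xb U (g_cvx t)); first exact: open_nbhs_nbhs.
    by rewrite gxb ltry.
  by move=> y /gm gmy; apply/eqP => gy; move: gmy; rewrite -/(g t y) gy.
have Lam_ge : (v%:E <= Lam g W)%E.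
  apply: le_trans g_ulsc; apply: le_ereal_inf_tmp => _ [x _ <-].
  by apply: le_osum => // t; exact: g_proper.
have [r r_gt0 rP] : exists2 r : R, 0 < r & forall x, `|x - xb| <= r -> U x /\ W x.
  have /nbhs_normP[e /= e_gt0 eP] : nbhs xb (U `&` W).
    by apply: filterI => //; exact: open_nbhs_nbhs.
  exists (e / 2); first exact: divr_gt0.
  by move=> x xe; apply: eP => /=; rewrite distrC; lra.
(* Below [eps] for the distances and the dual norm, and below [r] so that the Ekeland point is
   interior. *)
pose eta := Num.min (eps / 2) (r / 2).
have eta_gt0 : 0 < eta by rewrite lt_min !divr_gt0.
have eta_eps : eta < eps by rewrite gt_min; apply/orP; left; lra.
have eta_r : eta < r by rewrite gt_min; apply/orP; right; lra.
have [N NP] := fuzzy_gap g W v (eta ^+ 2) (exprn_gt0 2 eta_gt0) Lam_ge.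
pose n := maxn N (Num.bound M); have [delta delta_gt0 deltaP] := NP n (leq_maxl _ _).
exists n; split.
  by apply: lt_le_trans (archi_boundP (ltW M_gt0)) _; rewrite ler_nat leq_maxr.
have sum_c : \sum_(t <- head_indices n) c t = v.
  by rewrite sum_head_indices big_nat big1 ?addr0// => -[].
have [|||x [b [p [xbE b_le p_bdd p_le p_sum]]]] := @fuzzy_sum_rule R X (option nat)
    (head_indices n) (Some 0%N) g xb r (head_indices_uniq n) (mem_head _ _)
    g_cvx g_proper _ _ c eta delta (fun t _ => gxb t) eta_gt0 eta_r delta_gt0.
- by move=> t y /rP[Uy _]; exact: (gU t).1.
- by move=> t; have [_ [m gm]] := gU t; exists m => y /rP[Uy _]; exact: gm.
- by move=> y yr yd; rewrite sum_c; apply: deltaP => // t /yr/rP[].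
have mem_n k : (k <= n)%N -> Some k \in head_indices n by rewrite mem_head_indices.
have mem_None : None \in head_indices n by rewrite mem_head_indices.
have x_ball t : t \in head_indices n -> ball xb eps (x t).
  move=> /xbE[xt _]; rewrite -ball_normE /= distrC.
  exact: le_lt_trans xt eta_eps.
have p_dual t : t \in head_indices n -> dual_elem (p t).
  by move=> /p_bdd[p_lin [C pC]]; exact: bounded_dual_elem pC.
exists (fun k => x (Some k)), (x None); split; first by move=> k /mem_n/x_ball.
split; first exact: x_ball.
split.
  rewrite -sum_gfam f0xb (dsum_EFin _ _ _ b) => [|t /xbE[]//].
  by rewrite lee_fin -sum_c.
exists (p (Some 0%N)), (fun k => p (Some k)), (p None); split.
  have t_in := mem_n 0%N isT.
  apply: (subdiff_of_le _ _ _ _ (p_dual _ t_in) (xbE _ t_in).2) => y.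
  exact: p_le.
split.
  move=> [//|k] /andP[_ /mem_n t_in].
  apply: (scaled_subdiff_of_le _ _ _ _ _ (l_ge0 _) (p_dual _ t_in) (xbE _ t_in).2).
  by move=> y; exact: (p_le (Some k.+1)).
split.
  apply: (scaled_subdiff_of_le _ _ _ _ _ linf_ge0 (p_dual _ mem_None) (xbE _ mem_None).2).
  by move=> y; exact: (p_le None).
exists eta => // y; have := p_sum y; rewrite sum_head_indices; exact.
Qed.
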